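(* Let $a\in\mathbb{R}$, $\omega_{av}\in\mathbb{R}$ and $\sigma\ge 1$ be given. Let $\omega_0\in B_0$ be given such that $\omega_0$ has zero mean and $$\|\omega_0\|_{B_0}<\frac{1}{4(|1+a|+|a|)}.$$ Let $\varpi\in(0,1)$ be given such that $$\|\omega_0\|_{B_0}<\frac{1-\varpi}{4(|1+a|+|a|)}.$$ Then the initial value problem $$\omega_t+a\,u\,\omega_x=\omega\,\mathcal{H}(\omega)+\omega_{av}\,\mathcal{H}(\omega)-\Lambda^\sigma\omega,\qquad u_x=\mathcal{H}(\omega),\qquad \omega(\cdot,0)=\omega_0,$$ for $x\in\mathbb{S}$, $t>0$, has a unique solution $\omega\in\mathcal{B}^0_\varpi$.
   Context: $\mathbb{S}$ is the circle, i.e. $[-\pi,\pi]$ with periodic boundary conditions; functions are real-valued. For periodic $f$, $\hat f(k)$, $k\in\mathbb{Z}$, are its Fourier coefficients, $f(x)=\sum_k\hat f(k)e^{ikx}$. $\mathcal{H}$ is the periodic Hilbert transform, with Fourier symbol $-i\,\mathrm{sgn}(k)$ (zero at $k=0$). $\Lambda^\sigma$ is the Fourier multiplier with symbol $|k|^\sigma$. The function $u$ is determined by $u_x=\mathcal{H}(\omega)$ together with the requirement that $u$ has zero mean. The unknown $\omega$ has zero mean (the constant $\omega_{av}$ is the mean of the original vorticity $\omega+\omega_{av}$). The periodic Wiener algebra $B_0$ is the set of $f:\mathbb{S}\to\mathbb{R}$ with $\|f\|_{B_0}=\sum_{k\in\mathbb{Z}}|\hat f(k)|<\infty$. For $\varpi>0$,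 $\theta\ge0$, $\mathcal{B}^\theta_\varpi$ is the set of functions $h$ continuous in time $t\in[0,\infty)$ with values in $B_0$ such that $$\|h\|_{\varpi,\theta}=\sum_{k\in\mathbb{Z}}(1+|k|^\theta)\sup_{t\in[0,\infty)}e^{\varpi t|k|}|\hat h(k,t)|<\infty .$$ Solutions of the initial value problem are understood in the Duhamel (mild) sense, as fixed points of $\mathcal{T}$: $$\omega(\cdot,t)=\mathcal{T}(\omega)(\cdot,t)=e^{-t\mathcal{L}}\omega_0+\int_0^te^{-(t-\tau)\mathcal{L}}\,\mathbb{P}_0\big[(1+a)\,\omega\,\mathcal{H}(\omega)-a\,(u\omega)_x\big](\cdot,\tau)\,d\tau ,$$ where $e^{-t\mathcal{L}}$ is the Fourier multiplier with symbol $e^{-t|k|^\sigma-it\,\omega_{av}\,\mathrm{sgn}(k)}$ and $\mathbb{P}_0$ is the projection that removes the mean of a periodic function. *)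

(* Defs.v *)
From HB Require Import structures.
From mathcomp Require Import all_boot all_order all_algebra.
From mathcomp Require Import complex.
From mathcomp Require Import all_classical all_reals all_analysis.

Set Implicit Arguments.
Unset Strict Implicit.
Unset Printing Implicit Defensive.

Import Order.TTheory GRing.Theory Num.Theory.
Import numFieldNormedType.Exports.

Local Open Scope classical_set_scope.
Local Open Scope complex_scope.
Local Open Scope ring_scope.

(* Functions on the circle are 2 pi-periodic functions R -> R; a time-dependent
   function h : R -> R -> R takes the time first, and only its values at times
   t >= 0 are ever used. *)

Section Circle.
Context {R : realType}.
Implicit Types (f : R -> R) (k : int) (x : R) (m c : int -> R[i]).

(* e^{ix} *)
Definition expi x : R[i] := cos x +i* sin x.

Definition mean f : R :=
  (2 * pi)^-1 * \int[lebesgue_measure]_(x in `[- pi, pi]) f x.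

Definition fourier_coef f k : R[i] :=
  mean (fun x => complex.Re ((f x)%:C * expi (- (k%:~R * x))))
  +i* mean (fun x => complex.Im ((f x)%:C * expi (- (k%:~R * x)))).

(* The sum over k in Z of c k * e^{ikx}, as the limit of the partial sums over
   -n <= k <= n.  Only the real part is kept: all the functions considered are
   real-valued, i.e. c (- k) is the conjugate of c k. *)
Definition fourier_series c x : R :=
  limn (fun n : nat => \sum_(j < n.*2.+1)
    let k : int := j%:Z - n%:Z in complex.Re (c k * expi (k%:~R * x))).

Definition multiplier m f : R -> R :=
  fourier_series (fun k => m k * fourier_coef f k).

Definition hilbert : (R -> R) -> R -> R :=
  multiplier (fun k => 0 -i* (sgz k)%:~R).

(* |k|^r; at r = 0 and k = 0 this is 1. *)
Definition abs_pow (r : R) k : R := (`|k|%N%:R : R) `^ r.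

Definition wiener_norm f : \bar R :=
  \esum_(k in [set: int]) (Normc.normc (fourier_coef f k))%:E.

(* B_0; the last condition selects the continuous representative. *)
Definition wiener f : Prop :=
  [/\ periodic f (2 * pi),
      (wiener_norm f < +oo)%E &
      forall x, f x = fourier_series (fourier_coef f) x].

Definition spacetime_norm (varpi theta : R) (h : R -> R -> R) : \bar R :=
  (\esum_(k in [set: int])
     ((1 + abs_pow theta k)%:E *
      ereal_sup [set (expR (varpi * t * `|k|%N%:R) *
                      Normc.normc (fourier_coef (h t) k))%:E
                | t in [set t : R | (0 <= t)%R]]))%E.

Definition wiener_continuous (h : R -> R -> R) : Prop :=
  (forall t, 0 <= t -> wiener (h t)) /\
  (forall t0, 0 <= t0 ->
     wiener_norm (h t \- h t0) @[t --> within [set t | 0 <= t] (nbhs t0)]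
       --> 0%E).

Definition spacetime_space (varpi theta : R) (h : R -> R -> R) : Prop :=
  wiener_continuous h /\ (spacetime_norm varpi theta h < +oo)%E.

Definition velocity (w u : R -> R) : Prop :=
  [/\ periodic u (2 * pi), mean u = 0 &
      forall x, is_derive x 1 u (hilbert w x)].

Definition proj0 f : R -> R := fun x => f x - mean f.

Definition semigroup (w_av sigma t : R) : (R -> R) -> R -> R :=
  multiplier (fun k => (expR (- (t * abs_pow sigma k)))%:C *
                       expi (- (t * w_av * (sgz k)%:~R))).

Definition nonlinearity (a : R) (w u : R -> R) : R -> R :=
  fun x => (1 + a) * (w x * hilbert w x)
           - a * derive1 (fun y => u y * w y) x.

(* For w in B^0_varpi the product u w is smooth in x at every time tau > 0, so
   the integrand is meaningful except possibly at the endpoints of [0, t]. *)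
Definition duhamel (a w_av sigma : R) (w0 : R -> R) (w u : R -> R -> R)
    (t x : R) : R :=
  semigroup w_av sigma t w0 x +
  \int[lebesgue_measure]_(tau in `[0, t])
    semigroup w_av sigma (t - tau)
      (proj0 (nonlinearity a (w tau) (u tau))) x.

(* Such a w automatically has zero mean when w0 does, because of proj0. *)
Definition mild_solution (a w_av sigma : R) (w0 : R -> R) (w : R -> R -> R)
    : Prop :=
  exists u : R -> R -> R,
    (forall t, 0 <= t -> velocity (w t) (u t)) /\
    (forall t x, 0 <= t -> w t x = duhamel a w_av sigma w0 w u t x).

End Circle.

(* Main.v *)
Require Import Defs.
From HB Require Import structures.
From mathcomp Require Import all_boot all_order all_algebra.
From mathcomp Require Import complex.
From mathcomp Require Import all_classical all_reals all_analysis.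
From mathcomp Require Import ring lra zify.

(** The theorem is a statement about the Fourier coefficients c_k(t) of w.
    On coefficients the mild formulation reads

      c_k(t) = S_k(t) c_k(0) + int_0^t S_k(t - s) Q_k(c(s), c(s)) ds,
      Q_k(c, d) = sum_j q(k, j) c_j d_(k - j),

    where |S_k(t)| <= e^(- t |k|) because sigma >= 1, and where
    |q(k, j)| <= (|1 + a| + |a|) |k|: the nonlinearity costs one derivative.
    Suppose that |c_k(t)| <= m_k e^(- varpi t |k|) with m summable.  Since
    e^(- varpi s |j|) e^(- varpi s |k - j|) <= e^(- varpi s |k|) and
    int_0^t |k| e^(- (1 - varpi) (t - s) |k|) ds <= 1 / (1 - varpi), the time
    integral repays exactly the lost derivative, and the Duhamel term is at most
    K (m * m)_k e^(- varpi t |k|) with K = (|1 + a| + |a|) / (1 - varpi)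
    ([duhamel_le]).  The total mass X of the majorant is thereby governed by the
    scalar inequality X <= W + K X^2, where W is the Wiener norm of w0, and the
    hypothesis on w0 says that 4 K W < 1.

    Existence.  The iteration m |-> |c(0)| + K m * m started at 0 produces an
    increasing sequence of majorants of mass at most 2 W.  Because the Duhamel
    term is bilinear, the difference of two consecutive Picard iterates is
    dominated by the difference of the corresponding majorants
    ([picard_step]).  Hence the Picard iterates converge, and their limit is a
    solution ([mild_fixed]).

    Uniqueness.  A competitor is only assumed to lie in the space, not to be
    small.  Let X(T) be the sum over k of the suprema of
    e^(varpi t |k|) |c_k(t)| over t <= T.  It is continuous in T, X(0) <= W, and
    X <= W + K X^2 rules out the value 1 / (2 K); so X stays below 1 / (2 K)
    for all times ([size_upto_small]).  For two solutions with sizes X and Y the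
    corresponding size E of the difference satisfies E <= K (X + Y) E, whence
    E = 0 ([mild_coefs_unique]).

    The passage between functions and coefficients rests on three facts about
    absolutely convergent Fourier series: the coefficients of a product are a
    convolution ([fourier_coefM]), so that the coefficients of the nonlinearity
    are Q_k ([nonlinearity_coef]); such a series may be differentiated
    termwise when the differentiated series converges absolutely, which the
    exponential weight guarantees at positive times; and sum and time integral
    can be exchanged because |k| e^(- varpi t |k|) <= 1 / (varpi t)
    ([duhamel_term_series]). *)

Set Implicit Arguments.
Unset Strict Implicit.
Unset Printing Implicit Defensive.

Import Order.TTheory GRing.Theory Num.Theory.
Import numFieldNormedType.Exports.

Local Open Scope classical_set_scope.
Local Open Scope ring_scope.
Local Notation normc := Normc.normc.

(** * Absolutely convergent sums over the integers *)

Section Zsum.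
Context {R : realType}.
Implicit Types (f g m : int -> R) (k : int) (n : nat).

(** Symmetric windows match the partial sums of a Fourier series, and are
    invariant under [k |-> - k]. *)
Definition psum (V : nmodType) (f : int -> V) (n : nat) : V :=
  \sum_(j < n.*2.+1) f (j%:Z - n%:Z).

Lemma psum0 (V : nmodType) (f : int -> V) : psum f 0 = f 0.
Proof. by rewrite /psum big_ord_recl big_ord0 addr0 subrr. Qed.

Lemma psumS (V : nmodType) (f : int -> V) n :
  psum f n.+1 = psum f n + (f n.+1%:Z + f (- n.+1%:Z)).
Proof.
rewrite /psum doubleS big_ord_recl big_ord_recr /= [LHS]addrC -addrA.
congr (_ + (_ + _)).
- by apply: eq_bigr => j _; congr f; rewrite /bump /=; lia.
- by congr f; rewrite /bump /=; lia.
- by congr f; lia.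
Qed.

Lemma eq_psum (V : nmodType) (f g : int -> V) n :
  f =1 g -> psum f n = psum g n.
Proof. by move=> fg; apply: eq_bigr. Qed.

Lemma psumD (V : nmodType) (f g : int -> V) n :
  psum (fun k => f k + g k) n = psum f n + psum g n.
Proof. exact: big_split. Qed.

Lemma psumN (V : zmodType) (f : int -> V) n :
  psum (fun k => - f k) n = - psum f n.
Proof. by rewrite /psum sumrN. Qed.

Lemma psumZ (V : pzRingType) (a : V) (f : int -> V) n :
  psum (fun k => a * f k) n = a * psum f n.
Proof. by rewrite /psum mulr_sumr. Qed.

Lemma psum_refl (V : nmodType) (f : int -> V) n :
  psum (fun k => f (- k)) n = psum f n.
Proof.
elim: n => [|n IH]; first by rewrite !psum0 oppr0.
by rewrite !psumS IH opprK [f _ + _]addrC.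
Qed.

Lemma le_psum f g n : (forall k, f k <= g k) -> psum f n <= psum g n.
Proof. by move=> fg; apply: ler_sum. Qed.

Lemma psum_ge0 f n : (forall k, 0 <= f k) -> 0 <= psum f n.
Proof. by move=> f0; apply: sumr_ge0. Qed.

Lemma psum_nd f : (forall k, 0 <= f k) -> nondecreasing_seq (psum f).
Proof.
move=> f0; apply/nondecreasing_seqP => n.
by rewrite psumS lerDl addr_ge0.
Qed.

Lemma psum_norm_diff f m n p : (forall k, `|f k| <= m k) -> (n <= p)%N ->
  `|psum f p - psum f n| <= psum m p - psum m n.
Proof.
move=> fm; elim: p => [|p IH].
  by rewrite leqn0 => /eqP ->; rewrite !subrr normr0.
rewrite leq_eqVlt => /predU1P[->|np]; first by rewrite !subrr normr0.
rewrite !psumS addrAC [leRHS]addrAC (le_trans (ler_normD _ _))//.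
by rewrite lerD ?IH// (le_trans (ler_normD _ _))// lerD.
Qed.

Definition zsum f : R := limn (psum f).

Definition l1 f : Prop := cvgn (psum (fun k => `|f k|)).

Lemma eq_zsum f g : f =1 g -> zsum f = zsum g.
Proof. by move=> /funext ->. Qed.

Lemma l1_norm f : l1 (fun k => `|f k|) <-> l1 f.
Proof.
by rewrite /l1; under [X in psum X]funext do rewrite normr_id.
Qed.

Lemma nneg_l1P f (A : R) : (forall k, 0 <= f k) ->
  (forall n, psum f n <= A) -> l1 f /\ zsum f <= A.
Proof.
move=> f0 fA.
have cf : cvgn (psum f).
  apply: nondecreasing_is_cvgn; first exact: psum_nd.
  by exists A => _ [n _ <-].
split; last by apply: limr_le => //; apply: nearW.
by rewrite /l1; under [X in psum X]funext do rewrite ger0_norm//.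
Qed.

(** [f] is the difference of the nonnegative sequences [f + |f|] and [|f|], both
    with bounded and monotone partial sums. *)
Lemma l1_cvg f : l1 f -> cvgn (psum f).
Proof.
move=> lf.
have fE : psum f = (psum (fun k => f k + `|f k|) \- psum (fun k => `|f k|)).
  by apply/funext => n /=; rewrite psumD addrK.
rewrite fE; apply: is_cvgB => //.
apply: nondecreasing_is_cvgn.
  by apply: psum_nd => k; rewrite -lerBlDr sub0r lerNl ler_normr lexx orbT.
exists (2 * zsum (fun k => `|f k|)) => _ [n _ <-].
rewrite (@le_trans _ _ (psum (fun k => 2 * `|f k|) n))//.
  by apply: le_psum => k; rewrite mulrDl mul1r lerD ?ler_norm.
by rewrite psumZ ler_pM2l// nondecreasing_cvgn_le//; apply: psum_nd.
Qed.

Lemma cvg_psum f : l1 f -> psum f n @[n --> \oo] --> zsum f.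
Proof. exact: l1_cvg. Qed.

Lemma psum_le_zsum f n : l1 f -> (forall k, 0 <= f k) -> psum f n <= zsum f.
Proof.
by move=> lf f0; apply: nondecreasing_cvgn_le;
  [exact: psum_nd|exact: l1_cvg].
Qed.

Lemma l1_le f m : l1 m -> (forall k, `|f k| <= m k) -> l1 f.
Proof.
move=> lm fm; have m0 k : 0 <= m k by exact: le_trans (fm k).
apply: (proj1 (l1_norm f)); apply: (proj1 (@nneg_l1P _ (zsum m) _ _)) => // n.
by rewrite (le_trans _ (psum_le_zsum n lm m0))// le_psum.
Qed.

Lemma l1_term f k : l1 f -> `|f k| <= zsum (fun k => `|f k|).
Proof.
move=> lf; have {}lf := proj2 (l1_norm f) lf.
apply: le_trans (@psum_le_zsum _ `|k|%N lf _) => //.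
have f0 k' : 0 <= `|f k'| by [].
case: k => [[|n]|n] /=; first by rewrite psum0.
- by rewrite psumS addrCA lerDl addr_ge0// psum_ge0.
- by rewrite psumS addrA NegzE lerDr addr_ge0// psum_ge0.
Qed.

Lemma nneg_term_le f k : l1 f -> (forall k, 0 <= f k) -> f k <= zsum f.
Proof.
move=> lf f0; rewrite -[leLHS](ger0_norm (f0 k)) (le_trans (l1_term k lf))//.
by rewrite (_ : (fun k => `|f k|) = f)//; apply/funext => j; rewrite ger0_norm.
Qed.

Lemma zsum0 : zsum (fun=> 0) = 0.
Proof.
apply: cvg_lim => //; rewrite (_ : psum _ = fun=> 0); first exact: cvg_cst.
by apply/funext => n; rewrite /psum big1.
Qed.

Lemma l1_0 : l1 (fun=> 0).
Proof.
apply/cvg_ex; exists 0; rewrite (_ : psum _ = fun=> 0); first exact: cvg_cst.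
by apply/funext => n; rewrite /psum big1// => *; rewrite normr0.
Qed.

Lemma zsumD f g : l1 f -> l1 g ->
  zsum (fun k => f k + g k) = zsum f + zsum g.
Proof.
move=> lf lg; apply: cvg_lim => //.
rewrite (_ : psum _ = psum f \+ psum g); last by apply/funext => n; exact: psumD.
by apply: cvgD; exact: cvg_psum.
Qed.

Lemma zsumZ (a : R) f : l1 f -> zsum (fun k => a * f k) = a * zsum f.
Proof.
move=> lf; apply: cvg_lim => //.
rewrite (_ : psum _ = fun n => a * psum f n); last first.
  by apply/funext => n; exact: psumZ.
by apply: cvgMr; exact: cvg_psum.
Qed.

Lemma zsumB f g : l1 f -> l1 g ->
  zsum (fun k => f k - g k) = zsum f - zsum g.
Proof.
move=> lf lg; apply: cvg_lim => //.
rewrite (_ : psum _ = psum f \- psum g).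
  by apply: cvgB; exact: cvg_psum.
by apply/funext => n /=; rewrite psumD psumN.
Qed.

Lemma l1Z (a : R) f : l1 f -> l1 (fun k => a * f k).
Proof.
move=> lf; rewrite /l1; under [X in psum X]funext do rewrite normrM.
rewrite (_ : psum _ = fun n => `|a| * psum (fun k => `|f k|) n); last first.
  by apply/funext => n; exact: psumZ.
exact: is_cvgMr.
Qed.

Lemma l1D f g : l1 f -> l1 g -> l1 (fun k => f k + g k).
Proof.
move=> lf lg; apply: (@l1_le _ (fun k => `|f k| + `|g k|)); last first.
  by move=> k; exact: ler_normD.
rewrite /l1 (_ : psum _ = psum (fun k => `|f k|) \+ psum (fun k => `|g k|)).
  exact: is_cvgD.
by apply/funext => n /=; rewrite -psumD; apply: eq_psum => k; rewrite ger0_norm.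
Qed.

Lemma l1N f : l1 f -> l1 (fun k => - f k).
Proof. by move=> lf; apply: l1_le (proj2 (l1_norm f) lf) _ => k; rewrite normrN. Qed.

Lemma l1B f g : l1 f -> l1 g -> l1 (fun k => f k - g k).
Proof. by move=> lf lg; apply: l1D => //; exact: l1N. Qed.

Lemma le_zsum f g : l1 f -> l1 g -> (forall k, f k <= g k) -> zsum f <= zsum g.
Proof.
move=> lf lg fg; apply: ler_lim; [exact: l1_cvg|exact: l1_cvg|].
by apply: nearW => n; exact: le_psum.
Qed.

Lemma zsum_ge0 f : l1 f -> (forall k, 0 <= f k) -> 0 <= zsum f.
Proof. by move=> lf f0; rewrite -zsum0 le_zsum//; exact: l1_0. Qed.

(** Uniform in [f] for a given majorant [m]; this is what makes the exchanges of
    limits below possible. *)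
Lemma zsum_tail f m n : l1 m -> (forall k, `|f k| <= m k) ->
  `|zsum f - psum f n| <= zsum m - psum m n.
Proof.
move=> lm fm; have lf := l1_le lm fm.
have h1 : `|psum f p - psum f n| @[p --> \oo] --> `|zsum f - psum f n|.
  by apply: cvg_norm; apply: cvgB; [exact: cvg_psum|exact: cvg_cst].
have h2 : psum m p - psum m n @[p --> \oo] --> zsum m - psum m n.
  by apply: cvgB; [exact: cvg_psum|exact: cvg_cst].
apply: (ler_cvg_to h1 h2); exists n => // p /= np.
exact: psum_norm_diff.
Qed.

Lemma cvg_tail m : l1 m ->
  zsum m - psum m n @[n --> \oo] --> (0 : R).
Proof.
by move=> lm; rewrite -(subrr (zsum m)); apply: cvgB;
  [exact: cvg_cst|exact: cvg_psum].
Qed.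

Lemma cvg_psum_fin (T : Type) (F : set_system T) (FF : Filter F)
    (h : T -> int -> R) (l : int -> R) n :
  (forall k, h t k @[t --> F] --> l k) -> psum (h t) n @[t --> F] --> psum l n.
Proof.
move=> hl; elim: n => [|n IH].
  rewrite psum0 (_ : (fun t => psum (h t) 0) = h^~ 0)//.
  by apply/funext => t; rewrite psum0.
rewrite psumS (_ : (fun t => psum (h t) n.+1) =
    fun t => psum (h t) n + (h t n.+1%:Z + h t (- n.+1%:Z))); last first.
  by apply/funext => t; rewrite psumS.
by apply: cvgD => //; exact: cvgD.
Qed.

(** Tannery's theorem: up to a tail that is small uniformly in [t], only finitely
    many terms are involved. *)
Lemma zsum_cvg (T : Type) (F : set_system T) (FF : Filter F)
    (h : T -> int -> R) (l m : int -> R) :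
  l1 m -> (forall k, `|l k| <= m k) ->
  (\forall t \near F, forall k, `|h t k| <= m k) ->
  (forall k, h t k @[t --> F] --> l k) ->
  zsum (h t) @[t --> F] --> zsum l.
Proof.
move=> lm lem hm hl; have m0 k : 0 <= m k by exact: le_trans (lem k).
have ll : l1 l by exact: l1_le lem.
apply/cvgrPdist_lt => e e0.
have e4 : 0 < e / 4 by lra.
have /cvgrPdist_lt/(_ _ e4)[n _ /(_ n (leqnn n))] := cvg_tail lm.
rewrite sub0r normrN ger0_norm ?subr_ge0 ?psum_le_zsum// => tn.
have tailE g : (forall k, `|g k| <= m k) -> `|zsum g - psum g n| < e / 4.
  move=> gm; have lg := l1_le lm gm.
  by apply: le_lt_trans (zsum_tail n lm gm) _.
have hp : psum (h t) n @[t --> F] --> psum l n.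
  exact: cvg_psum_fin.
move/cvgrPdist_lt : hp => /(_ _ e4); move: hm; apply: filterS2 => t hm hp.
rewrite (_ : zsum l - zsum (h t) = (zsum l - psum l n)
  + ((psum l n - psum (h t) n) - (zsum (h t) - psum (h t) n))); last by ring.
have := tailE _ lem; have := tailE _ hm.
rewrite !ltr_norml => /andP[a1 a2] /andP[b1 b2].
move: hp; rewrite ltr_norml => /andP[c1 c2]; apply/andP; split; lra.
Qed.

End Zsum.

(** * Unordered sums and convolution *)

Section Esum.
Context {R : realType}.
Implicit Types (f g m : int -> R) (k : int) (n : nat).

Lemma psum_esum f n : (forall k, 0 <= f k) ->
  ((psum f n)%:E <= \esum_(k in [set: int]) (f k)%:E)%E.
Proof.
move=> f0; pose s := [seq (j%:Z - n%:Z) | j <- iota 0 n.*2.+1].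
have us : uniq s by rewrite map_inj_uniq ?iota_uniq// => i j; lia.
apply: esum_ge; exists [set` s]; first by split => //; exact: finite_seq.
rewrite -(fsbig_seq _ _ us) /s big_map -/(index_iota 0 n.*2.+1) big_mkord sumEFin.
by rewrite lee_fin.
Qed.

(** Every finite set of integers lies in a symmetric window. *)
Lemma esum_le_psum f (A : \bar R) : (forall k, 0 <= f k) ->
  (forall n, ((psum f n)%:E <= A)%E) ->
  (\esum_(k in [set: int]) (f k)%:E <= A)%E.
Proof.
move=> f0 fA; apply: ge_ereal_sup => _ [X [/finite_seqP[r ->] _] <-].
pose n := \max_(k <- r) `|k|%N; apply: le_trans (fA n).
pose s := [seq (j%:Z - n%:Z) | j <- iota 0 n.*2.+1].
have us : uniq s by rewrite map_inj_uniq ?iota_uniq// => i j; lia.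
have -> : psum f n = \sum_(k <- s) f k.
  by rewrite /s big_map -/(index_iota 0 n.*2.+1) big_mkord.
rewrite -sumEFin (fsbig_seq _ _ us).
apply: lee_fsum_nneg_subset; [exact: finite_seq|exact: finite_seq| |].
  move=> k; rewrite !inE /= => kr; apply/mapP.
  have kn : (`|k|%N <= n)%N by rewrite /n; exact: (leq_bigmax_seq (F := fun k => `|k|%N)).
  by exists (absz ((k : int) + n%:Z)); rewrite ?mem_iota; lia.
by move=> k _; rewrite lee_fin.
Qed.

Lemma l1_esum f : (forall k, 0 <= f k) ->
  (\esum_(k in [set: int]) (f k)%:E < +oo)%E -> l1 f.
Proof.
move=> f0 h; have fin : \esum_(k in [set: int]) (f k)%:E \is a fin_num.
  by rewrite ge0_fin_numE// esum_ge0// => k _; rewrite lee_fin.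
apply: (proj1 (@nneg_l1P _ _ (fine (\esum_(k in [set: int]) (f k)%:E)%E) _ _)) => // n.
by rewrite -lee_fin fineK// psum_esum.
Qed.

Lemma esum_zsum f : (forall k, 0 <= f k) -> l1 f ->
  (\esum_(k in [set: int]) (f k)%:E = (zsum f)%:E)%E.
Proof.
move=> f0 lf; have le1 : (\esum_(k in [set: int]) (f k)%:E <= (zsum f)%:E)%E.
  by apply: esum_le_psum => // n; rewrite lee_fin psum_le_zsum.
have fin : \esum_(k in [set: int]) (f k)%:E \is a fin_num.
  rewrite ge0_fin_numE ?(le_lt_trans le1) ?ltry// esum_ge0// => k _.
  by rewrite lee_fin.
apply/eqP; rewrite eq_le le1 /= -[leRHS]fineK// lee_fin.
apply: limr_le; first exact: l1_cvg.
by apply: nearW => n; rewrite -lee_fin fineK// psum_esum.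
Qed.

(** Symmetric windows are not invariant under shifts; unordered sums are. *)
Lemma nneg_shift m k : (forall j, 0 <= m j) -> l1 m ->
  l1 (fun j => m (k - j)) /\ zsum (fun j => m (k - j)) = zsum m.
Proof.
move=> m0 lm.
have eE : (\esum_(j in [set: int]) (m j)%:E =
           \esum_(j in [set: int]) (m (k - j))%:E)%E.
  apply: (@reindex_esum _ int int setT setT (fun j => k - j)); split => //=.
    by move=> i j _ _ /(congr1 (fun x => k - x)); rewrite !subKr.
  by move=> j _; exists (k - j) => //; rewrite subKr.
have l1s : l1 (fun j => m (k - j)).
  by apply: l1_esum => //; rewrite -eE esum_zsum// ltry.
split=> //; apply: EFin_inj; rewrite -!esum_zsum//.
Qed.

Lemma esum_term (b : int -> \bar R) k : (forall j, 0 <= b j)%E ->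
  (b k <= \esum_(j in [set: int]) b j)%E.
Proof.
move=> b0; apply: esum_ge; exists [set k]; first by split => //; exact: finite_set1.
by rewrite fsbig_set1.
Qed.

Definition conv m m' k : R := zsum (fun j => m j * m' (k - j)).

Lemma l1_conv_term m m' k : l1 m -> l1 m' -> l1 (fun j => m j * m' (k - j)).
Proof.
move=> lm lm'; have lZ := @l1Z _ (zsum (fun j => `|m' j|)) _ (proj2 (l1_norm m) lm).
apply: (l1_le lZ) => j; rewrite normrM [leRHS]mulrC.
by rewrite ler_wpM2l// l1_term.
Qed.
Arguments l1_conv_term {m m'} k.

Lemma conv_ge0 m m' k : l1 m -> l1 m' -> (forall j, 0 <= m j) ->
  (forall j, 0 <= m' j) -> 0 <= conv m m' k.
Proof.
move=> lm lm' m0 m'0; apply: zsum_ge0 => [|j]; last by rewrite mulr_ge0.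
exact: l1_conv_term.
Qed.

(** Young's inequality in the space of summable sequences: sum over [k] first,
    for each fixed [j]. *)
Lemma l1_conv m m' : l1 m -> l1 m' -> (forall j, 0 <= m j) ->
  (forall j, 0 <= m' j) ->
  l1 (conv m m') /\ zsum (conv m m') <= zsum m * zsum m'.
Proof.
move=> lm lm' m0 m'0; apply: nneg_l1P => [k|n]; first exact: conv_ge0.
have psumE : l1 (fun j => m j * psum (fun k => m' (k - j)) n) /\
    psum (conv m m') n = zsum (fun j => m j * psum (fun k => m' (k - j)) n).
  elim: n => [|n [ln IH]].
    rewrite psum0; split; last by apply: eq_zsum => j; rewrite psum0.
    have := l1_conv_term 0 lm lm'.
    by congr l1; apply/funext => j; rewrite psum0.
  have fE : (fun j => m j * psum (fun k => m' (k - j)) n.+1) =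
     (fun j => m j * psum (fun k => m' (k - j)) n +
       (m j * m' (n.+1%:Z - j) + m j * m' (- n.+1%:Z - j))).
    by apply/funext => j; rewrite psumS !mulrDr.
  have l3 := l1D (l1_conv_term n.+1%:Z lm lm') (l1_conv_term (- n.+1%:Z) lm lm').
  rewrite fE; split; first exact: l1D.
  by rewrite psumS IH !zsumD//; exact: l1_conv_term.
have [ln ->] := psumE; rewrite mulrC -zsumZ//; apply: le_zsum => //.
  exact: l1Z.
move=> j; rewrite mulrC ler_wpM2r//.
have [ls <-] := nneg_shift (- j) m'0 lm'.
rewrite -psum_refl (le_trans _ (psum_le_zsum n ls _))//.
by apply: le_psum => k; rewrite addrC.
Qed.

Lemma le_conv m1 m2 p1 p2 k : l1 m1 -> l1 m2 -> l1 p1 -> l1 p2 ->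
  (forall j, 0 <= m1 j <= m2 j) -> (forall j, 0 <= p1 j <= p2 j) ->
  conv m1 p1 k <= conv m2 p2 k.
Proof.
move=> ? ? ? ? hm hp; apply: le_zsum; [exact: l1_conv_term|exact: l1_conv_term|].
move=> j; have /andP[? ?] := hm j; have /andP[? ?] := hp (k - j).
exact: ler_pM.
Qed.

Lemma convDl m1 m2 p k : l1 m1 -> l1 m2 -> l1 p ->
  conv (fun j => m1 j + m2 j) p k = conv m1 p k + conv m2 p k.
Proof.
move=> ? ? ?; rewrite /conv -zsumD; [|exact: l1_conv_term..].
by apply: eq_zsum => j; rewrite mulrDl.
Qed.

Lemma convDr p m1 m2 k : l1 m1 -> l1 m2 -> l1 p ->
  conv p (fun j => m1 j + m2 j) k = conv p m1 k + conv p m2 k.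
Proof.
move=> ? ? ?; rewrite /conv -zsumD; [|exact: l1_conv_term..].
by apply: eq_zsum => j; rewrite mulrDr.
Qed.

End Esum.
Arguments l1_conv_term {R m m'} k.

(** * Complex-valued sums *)

Section Complex.
Context {R : realType}.
Implicit Types (z w : R[i]) (f g : int -> R[i]) (k : int).

Lemma normc_ge0 z : 0 <= normc z.
Proof. by case: z => a b; exact: sqrtr_ge0. Qed.

Lemma normc_real (x : R) : normc (x%:C)%C = `|x|.
Proof. by rewrite /= expr0n addr0 sqrtr_sqr. Qed.

Lemma normcB z w : normc (z - w) = normc (w - z).
Proof. by rewrite -opprB normcN. Qed.

Lemma normc_conj z : normc (conjc z) = normc z.
Proof. by case: z => a b /=; rewrite sqrrN. Qed.

Lemma normc_dot z (a b : R) : a ^+ 2 + b ^+ 2 <= 1 ->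
  a * complex.Re z + b * complex.Im z <= normc z.
Proof.
case: z => x y /= ab; rewrite (le_trans (ler_norm _))//.
rewrite -sqrtr_sqr ler_sqrt; last by rewrite addr_ge0 ?sqr_ge0.
apply: (@le_trans _ _ ((a ^+ 2 + b ^+ 2) * (x ^+ 2 + y ^+ 2))).
  by rewrite -subr_ge0 (_ : _ - _ = (a * y - b * x) ^+ 2) ?sqr_ge0//; ring.
by rewrite ler_piMl ?addr_ge0 ?sqr_ge0.
Qed.

(** A modulus is a supremum of real linear functionals.  This turns the triangle
    inequality for real sums and integrals into the complex one without loss of
    a constant, which the sharp threshold on the data requires. *)
Lemma normc_le_dot z (r : R) :
  (forall a b : R, a ^+ 2 + b ^+ 2 <= 1 ->
     a * complex.Re z + b * complex.Im z <= r) -> normc z <= r.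
Proof.
move=> h; have [z0|z0] := eqVneq (normc z) 0.
  by rewrite z0; have := h 0 0; rewrite !mul0r !expr0n !addr0; apply.
have n0 : 0 < normc z by rewrite lt_def z0 normc_ge0.
have sq : complex.Re z ^+ 2 + complex.Im z ^+ 2 = normc z ^+ 2.
  by case: (z) => x y /=; rewrite sqr_sqrtr// addr_ge0 ?sqr_ge0.
have := h (complex.Re z / normc z) (complex.Im z / normc z).
rewrite !expr_div_n -mulrDl sq divff ?expf_neq0// => /(_ (lexx _)).
rewrite (_ : _ + _ = (complex.Re z ^+ 2 + complex.Im z ^+ 2) / normc z); last by ring.
by rewrite sq expr2 mulfK.
Qed.

Lemma normc_Re z : `|complex.Re z| <= normc z.
Proof.
rewrite ler_norml; apply/andP; split.
  by have := @normc_dot z (-1) 0; rewrite sqrrN expr1n expr0n addr0 mul0r addr0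
    mulN1r lerNl; exact.
by have := @normc_dot z 1 0; rewrite expr1n expr0n addr0 mul0r addr0 mul1r; exact.
Qed.

Lemma normc_Im z : `|complex.Im z| <= normc z.
Proof.
rewrite ler_norml; apply/andP; split.
  by have := @normc_dot z 0 (-1); rewrite sqrrN expr1n expr0n add0r mul0r add0r
    mulN1r lerNl; exact.
by have := @normc_dot z 0 1; rewrite expr1n expr0n add0r mul0r add0r mul1r; exact.
Qed.

Lemma normc_le_ReIm z : normc z <= `|complex.Re z| + `|complex.Im z|.
Proof.
case: z => x y /=; rewrite -(ler_pXn2r (n := 2)) ?nnegrE ?addr_ge0 ?sqrtr_ge0//.
rewrite sqr_sqrtr ?addr_ge0 ?sqr_ge0// sqrrD !real_normK ?num_real//.
by rewrite lerD2r lerDl mulrn_wge0// mulr_ge0.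
Qed.

Lemma cReD z w : complex.Re (z + w) = complex.Re z + complex.Re w.
Proof. by case: z w => ? ? []. Qed.
Lemma cImD z w : complex.Im (z + w) = complex.Im z + complex.Im w.
Proof. by case: z w => ? ? []. Qed.
Lemma cReN z : complex.Re (- z) = - complex.Re z.
Proof. by case: z. Qed.
Lemma cImN z : complex.Im (- z) = - complex.Im z.
Proof. by case: z. Qed.
Lemma cReM z w : complex.Re (z * w) =
  complex.Re z * complex.Re w - complex.Im z * complex.Im w.
Proof. by case: z w => ? ? []. Qed.
Lemma cImM z w : complex.Im (z * w) =
  complex.Re z * complex.Im w + complex.Im z * complex.Re w.
Proof. by case: z w => ? ? []. Qed.
Lemma cRe_conj z : complex.Re (conjc z) = complex.Re z.
Proof. by case: z. Qed.
Lemma cIm_conj z : complex.Im (conjc z) = - complex.Im z.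
Proof. by case: z. Qed.
Lemma complex_ext z w : complex.Re z = complex.Re w ->
  complex.Im z = complex.Im w -> z = w.
Proof. by case: z w => a b [c d] /= -> ->. Qed.

Lemma cconjM (z w : R[i]) : conjc (z * w) = conjc z * conjc w.
Proof. exact: rmorphM. Qed.

Lemma cconjK (z : R[i]) : conjc (conjc z) = z.
Proof. exact: conjcK. Qed.

Lemma cconjD (z w : R[i]) : conjc (z + w) = conjc z + conjc w.
Proof. exact: rmorphD. Qed.

Lemma cconj_real (x : R) : conjc (x%:C)%C = (x%:C)%C.
Proof. by apply: complex_ext; rewrite /= ?oppr0. Qed.

Definition cl1 f : Prop := l1 (fun k => normc (f k)).

Definition czsum f : R[i] :=
  (zsum (fun k => complex.Re (f k)) +i* zsum (fun k => complex.Im (f k)))%C.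

Lemma cl1_le f (m : int -> R) : l1 m -> (forall k, normc (f k) <= m k) -> cl1 f.
Proof. by move=> lm fm; apply: l1_le lm _ => k; rewrite ger0_norm ?normc_ge0. Qed.

Lemma cl1_Re f : cl1 f -> l1 (fun k => complex.Re (f k)).
Proof. by move=> lf; apply: l1_le lf _ => k; exact: normc_Re. Qed.

Lemma cl1_Im f : cl1 f -> l1 (fun k => complex.Im (f k)).
Proof. by move=> lf; apply: l1_le lf _ => k; exact: normc_Im. Qed.

Lemma cl1D f g : cl1 f -> cl1 g -> cl1 (fun k => f k + g k).
Proof. by move=> lf lg; apply: cl1_le (l1D lf lg) _ => k; exact: le_normcD. Qed.

Lemma cl1N f : cl1 f -> cl1 (fun k => - f k).
Proof. by move=> lf; apply: cl1_le lf _ => k; rewrite normcN. Qed.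

Lemma cl1Z z f : cl1 f -> cl1 (fun k => z * f k).
Proof.
by move=> lf; apply: cl1_le (@l1Z _ (normc z) _ lf) _ => k; rewrite Normc.normcM.
Qed.

Lemma czsumD f g : cl1 f -> cl1 g ->
  czsum (fun k => f k + g k) = czsum f + czsum g.
Proof.
move=> lf lg; apply: complex_ext; rewrite ?cReD ?cImD /=.
  by rewrite -zsumD; [apply: eq_zsum => k; rewrite cReD|exact: cl1_Re..].
by rewrite -zsumD; [apply: eq_zsum => k; rewrite cImD|exact: cl1_Im..].
Qed.

Lemma czsumZ z f : cl1 f -> czsum (fun k => z * f k) = z * czsum f.
Proof.
move=> lf; have l1Re := cl1_Re lf; have l1Im := cl1_Im lf.
apply: complex_ext; rewrite ?cReM ?cImM /=.
  rewrite -!zsumZ// -zsumB; [|exact: l1Z..].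
  by apply: eq_zsum => k; rewrite cReM.
rewrite -!zsumZ// -zsumD; [|exact: l1Z..].
by apply: eq_zsum => k; rewrite cImM.
Qed.

Lemma normc_czsum f : cl1 f -> normc (czsum f) <= zsum (fun k => normc (f k)).
Proof.
move=> lf; have l1Re := cl1_Re lf; have l1Im := cl1_Im lf.
apply: normc_le_dot => a b ab /=; rewrite -!zsumZ// -zsumD; [|exact: l1Z..].
by apply: le_zsum => // [|k]; [apply: l1D; exact: l1Z|exact: normc_dot].
Qed.

Lemma zsum_refl (f : int -> R) : zsum (fun k => f (- k)) = zsum f.
Proof. by congr (limn _); apply/funext => n; rewrite psum_refl. Qed.

Lemma l1_refl (f : int -> R) : l1 f -> l1 (fun k => f (- k)).
Proof.
move=> lf; rewrite /l1 (_ : psum _ = psum (fun k => `|f k|))//.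
by apply/funext => n; exact: (psum_refl (fun k => `|f k|)).
Qed.

Lemma czsum_conj_refl f : cl1 f -> czsum (fun k => conjc (f (- k))) = conjc (czsum f).
Proof.
move=> lf; apply: complex_ext; rewrite ?cRe_conj ?cIm_conj /=.
  by rewrite -zsum_refl; apply: eq_zsum => k; rewrite cRe_conj opprK.
rewrite -zsum_refl -[RHS]add0r -[X in X - _](@zsum0 R) -zsumB; last 2 first.
- exact: l1_0.
- exact: cl1_Im.
by apply: eq_zsum => k; rewrite cIm_conj opprK sub0r.
Qed.

End Complex.

(** * Integrals of continuous functions over segments *)

Section Integrals.
Context {R : realType}.
Implicit Types (a b x t : R) (f : R -> R) (g : R -> R[i]) (k : int).

Definition rint a b f : R := \int[lebesgue_measure]_(x in `[a, b]) f x.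

Lemma rint_integrable a b f : continuous f ->
  (@lebesgue_measure R).-integrable `[a, b] (EFin \o f).
Proof.
move=> cf; apply: continuous_compact_integrable; first exact: segment_compact.
exact: continuous_subspaceT.
Qed.

Arguments rint_integrable a b {f}.

Lemma eq_rint a b f1 f2 : (forall x, a <= x <= b -> f1 x = f2 x) ->
  rint a b f1 = rint a b f2.
Proof.
by move=> e; apply: eq_Rintegral => x; rewrite inE /= in_itv /= => /e.
Qed.

Lemma rintD a b f1 f2 : continuous f1 -> continuous f2 ->
  rint a b (fun x => f1 x + f2 x) = rint a b f1 + rint a b f2.
Proof. by move=> c1 c2; apply: RintegralD => //; exact: rint_integrable. Qed.

Lemma rintB a b f1 f2 : continuous f1 -> continuous f2 ->
  rint a b (fun x => f1 x - f2 x) = rint a b f1 - rint a b f2.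
Proof. by move=> c1 c2; apply: RintegralB => //; exact: rint_integrable. Qed.

Lemma rintZ a b (r : R) f : continuous f ->
  rint a b (fun x => r * f x) = r * rint a b f.
Proof. by move=> c1; apply: RintegralZl => //; exact: rint_integrable. Qed.

Lemma rint_cst a b (r : R) : a <= b -> rint a b (fun=> r) = r * (b - a).
Proof.
move=> ab; rewrite /rint Rintegral_cst//= lebesgue_measure_itv /= lte_fin.
by move: ab; rewrite le_eqVlt => /predU1P[->|->]; rewrite ?ltxx ?subrr.
Qed.

Lemma rint_set1 a f : rint a a f = 0.
Proof. by rewrite /rint set_itv1 Rintegral_set1. Qed.

Lemma le_rint a b f1 f2 : continuous f1 -> continuous f2 ->
  (forall x, a <= x <= b -> f1 x <= f2 x) -> rint a b f1 <= rint a b f2.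
Proof.
move=> c1 c2 le12; apply: le_Rintegral => //; exact: rint_integrable.
Qed.

Lemma ler_norm_rint a b f1 f2 : continuous f1 -> continuous f2 ->
  (forall x, a <= x <= b -> `|f1 x| <= f2 x) -> `|rint a b f1| <= rint a b f2.
Proof.
move=> c1 c2 le12; rewrite ler_norml -mulN1r -rintZ//; apply/andP; split.
  apply: le_rint => // [x|x /le12].
    by apply: cvgM; [exact: cvg_cst|exact: c2].
  by rewrite ler_norml mulN1r => /andP[].
by apply: le_rint => // x /le12; exact: le_trans (ler_norm _).
Qed.

Lemma zsum_continuous (T : topologicalType) (h : T -> int -> R) (m : int -> R) :
  l1 m -> (forall (y : T) k, `|h y k| <= m k) ->
  (forall k, continuous (h^~ k)) -> continuous (fun y => zsum (h y)).
Proof.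
move=> lm hm ch x; apply: zsum_cvg lm _ _ _ => //.
- by apply: nearW.
- by move=> k; exact: ch.
Qed.

Lemma psum_continuous (T : topologicalType) (h : T -> int -> R) n :
  (forall k, continuous (h^~ k)) -> continuous (fun y => psum (h y) n).
Proof. by move=> ch x; apply: cvg_psum_fin => k; exact: ch. Qed.

Arguments psum_continuous {T h} n.

Lemma rint_psum a b (h : R -> int -> R) n :
  (forall k, continuous (h^~ k)) ->
  rint a b (fun x => psum (h x) n) = psum (fun k => rint a b (h^~ k)) n.
Proof.
move=> ch; elim: n => [|n IH].
  by rewrite psum0; apply: eq_rint => x _; rewrite psum0.
rewrite psumS -IH -!rintD//.
- by apply: eq_rint => x _; rewrite psumS.
- exact: psum_continuous.
- by move=> x; apply: cvgD; exact: ch.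
Qed.

Lemma rint_psum_cvg a b (h : R -> int -> R) (m : int -> R) : a <= b ->
  l1 m -> (forall x k, a <= x <= b -> `|h x k| <= m k) ->
  (forall k, continuous (h^~ k)) -> continuous (fun x => zsum (h x)) ->
  psum (fun k => rint a b (h^~ k)) n @[n --> \oo] -->
    rint a b (fun x => zsum (h x)).
Proof.
move=> ab lm hm ch cz; apply/cvgrPdist_le => e e0.
have tl : (zsum m - psum m n) * (b - a) @[n --> \oo] --> (0 : R).
  by rewrite -(mul0r (b - a)); apply: cvgM; [exact: cvg_tail|exact: cvg_cst].
move/cvgrPdist_le : tl => /(_ _ e0); apply: filterS => n; rewrite sub0r normrN => tn.
have cp := psum_continuous n ch.
rewrite -rint_psum// -rintB//; apply: le_trans (le_trans (ler_norm _) tn).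
rewrite -rint_cst//; apply: ler_norm_rint.
- by move=> x; apply: cvgB; [exact: cz|exact: cp].
- by move=> x; exact: cvg_cst.
- by move=> x xab; apply: zsum_tail => // k; exact: hm.
Qed.

(** The tails of the series are small uniformly on the segment. *)
Lemma rint_zsum a b (h : R -> int -> R) (m : int -> R) : a <= b ->
  l1 m -> (forall x k, a <= x <= b -> `|h x k| <= m k) ->
  (forall k, continuous (h^~ k)) -> continuous (fun x => zsum (h x)) ->
  rint a b (fun x => zsum (h x)) = zsum (fun k => rint a b (h^~ k)).
Proof.
move=> ab lm hm ch cz.
by apply/esym/cvg_lim => //; exact: rint_psum_cvg lm hm ch cz.
Qed.

Lemma rint_FTC a b (F f : R -> R) : a <= b -> continuous f ->
  (forall x, is_derive x 1 F (f x)) -> rint a b f = F b - F a.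
Proof.
rewrite le_eqVlt => /predU1P[<- _ _|ab cf dF].
  by rewrite rint_set1 subrr.
have cF : continuous F.
  move=> x; apply: differentiable_continuous; apply/derivable1_diffP.
  by have [] := dF x.
rewrite /rint /Rintegral (@continuous_FTC2 _ f F a b)//.
- exact: continuous_subspaceT.
- by split => [x _| |]; [have [] := dF x|exact/cvg_at_right_filter/cF|
    exact/cvg_at_left_filter/cF].
- by move=> x _; rewrite derive1E; have [] := dF x.
Qed.

(** Integrating from -1 instead of 0 makes every nonnegative time an interior
    point, where the fundamental theorem of calculus gives differentiability. *)
Lemma rint_primitive_continuous f : continuous f ->
  continuous (fun t => rint 0 (Num.max 0 t) f).
Proof.
move=> cf; pose G x := rint (-1) x f.
have cG s : 0 <= s -> {for s, continuous G}.
  move=> s0; have [dG _] : derivable G s 1 /\ derive1 G s = f s.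
    apply: (@continuous_FTC1_closed _ f (-1) s (s + 1)); last exact: cf.
    - lra.
    - exact: rint_integrable.
    - lra.
  by apply: differentiable_continuous; apply/derivable1_diffP.
have PE t : rint 0 (Num.max 0 t) f = G (Num.max 0 t) - G 0.
  have m0 : 0 <= Num.max 0 t by rewrite le_max lexx.
  rewrite /G /rint -Rintegral_itv_obnd_cbnd; last first.
    apply: integrableS (rint_integrable 0 (Num.max 0 t) cf) => //.
    exact: subset_itv_oc_cc.
  rewrite -(@Rintegral_itvB _ f (BLeft (-1)) (BRight (Num.max 0 t)) 0)//.
  - exact: rint_integrable.
  - by rewrite bnd_simp; lra.
rewrite (_ : (fun t => _) = (fun t => G (Num.max 0 t) - G 0)); last first.
  exact/funext.
move=> t; apply: cvgB; last exact: cvg_cst.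
apply: (@continuous_comp _ _ _ (fun t => Num.max 0 t) G).
  by apply: continuous_max; [exact: cvg_cst|exact: cvg_id].
by apply: cG; rewrite le_max lexx.
Qed.

(** A single point has measure zero.  At time 0 the nonlinearity
    contains the derivative of a function that need not be differentiable, so its
    formula on coefficients is available on the half-open interval only. *)
Lemma eq_rint_oc a b f h : continuous h -> (forall x, a < x <= b -> f x = h x) ->
  rint a b f = rint a b h.
Proof.
move=> ch fg; rewrite /rint.
have ig : (@lebesgue_measure R).-integrable `]a, b] (EFin \o h).
  by apply: integrableS (rint_integrable a b ch) => //; exact: subset_itv_oc_cc.
have fgE : {in `]a, b]%classic, EFin \o f =1 EFin \o h}.
  by move=> x; rewrite inE /= in_itv /= => /fg ->.
rewrite -!Rintegral_itv_obnd_cbnd//; last first.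
  by apply: eq_integrable ig => // x /fgE.
by apply: eq_Rintegral => x; rewrite inE /= in_itv /= => /fg ->.
Qed.

Definition ccont g : Prop :=
  continuous (fun x => complex.Re (g x)) /\ continuous (fun x => complex.Im (g x)).

Definition cint a b g : R[i] :=
  (rint a b (fun x => complex.Re (g x)) +i* rint a b (fun x => complex.Im (g x)))%C.

Lemma ccontD g1 g2 : ccont g1 -> ccont g2 -> ccont (fun x => g1 x + g2 x).
Proof.
move=> [r1 i1] [r2 i2]; split => x.
  by under eq_fun do rewrite cReD; apply: cvgD; [exact: r1|exact: r2].
by under eq_fun do rewrite cImD; apply: cvgD; [exact: i1|exact: i2].
Qed.

Lemma ccontM g1 g2 : ccont g1 -> ccont g2 -> ccont (fun x => g1 x * g2 x).
Proof.
move=> [r1 i1] [r2 i2]; split => x.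
  under eq_fun do rewrite cReM.
  by apply: cvgB; apply: cvgM; [exact: r1|exact: r2|exact: i1|exact: i2].
under eq_fun do rewrite cImM.
by apply: cvgD; apply: cvgM; [exact: r1|exact: i2|exact: i1|exact: r2].
Qed.

Lemma ccontN g : ccont g -> ccont (fun x => - g x).
Proof.
move=> [r i]; split => x.
  by under eq_fun do rewrite cReN; apply: cvgN; exact: r.
by under eq_fun do rewrite cImN; apply: cvgN; exact: i.
Qed.

Lemma ccont_conj g : ccont g -> ccont (fun x => conjc (g x)).
Proof.
move=> [r i]; split => x.
  by under eq_fun do rewrite cRe_conj; exact: r.
by under eq_fun do rewrite cIm_conj; apply: cvgN; exact: i.
Qed.

Lemma ccont_cst (z : R[i]) : ccont (fun=> z).
Proof. by split => x; exact: cvg_cst. Qed.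

Lemma ccont_real f : continuous f -> ccont (fun x => (f x)%:C%C).
Proof. by move=> cf; split => //= x; exact: cvg_cst. Qed.

Lemma ccont_comp g (s : R -> R) : ccont g -> continuous s -> ccont (g \o s).
Proof.
by move=> [r i] cs; split => x;
  [exact: (continuous_comp (cs x) (r _))|exact: (continuous_comp (cs x) (i _))].
Qed.

Lemma eq_cint a b g1 g2 : (forall x, a <= x <= b -> g1 x = g2 x) ->
  cint a b g1 = cint a b g2.
Proof. by move=> e; congr Complex; apply: eq_rint => x /e ->. Qed.

Lemma cintD a b g1 g2 : ccont g1 -> ccont g2 ->
  cint a b (fun x => g1 x + g2 x) = cint a b g1 + cint a b g2.
Proof.
move=> [r1 i1] [r2 i2]; apply: complex_ext; rewrite ?cReD ?cImD /= -rintD//.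
  by apply: eq_rint => x _; rewrite cReD.
by apply: eq_rint => x _; rewrite cImD.
Qed.

Lemma cintZ a b (z : R[i]) g : ccont g ->
  cint a b (fun x => z * g x) = z * cint a b g.
Proof.
move=> [r i].
have cZ (c : R) f : continuous f -> continuous (fun x => c * f x).
  by move=> cf x; apply: cvgM; [exact: cvg_cst|exact: cf].
apply: complex_ext; rewrite ?cReM ?cImM /= -!rintZ//.
  by rewrite -rintB; [apply: eq_rint => x _; rewrite cReM|exact: cZ..].
by rewrite -rintD; [apply: eq_rint => x _; rewrite cImM|exact: cZ..].
Qed.

Lemma normc_cint a b g f : ccont g -> continuous f ->
  (forall x, a <= x <= b -> normc (g x) <= f x) ->
  normc (cint a b g) <= rint a b f.
Proof.
move=> [r i] cf gf.
have cZ (c : R) h : continuous h -> continuous (fun x => c * h x).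
  by move=> ch x; apply: cvgM; [exact: cvg_cst|exact: ch].
apply: normc_le_dot => c d cd /=; rewrite -!rintZ// -rintD; [|exact: cZ..].
apply: le_rint => // [x|x /gf]; last exact/le_trans/normc_dot.
by apply: cvgD; exact: cZ.
Qed.

Lemma cint_conj a b g : ccont g ->
  cint a b (fun x => conjc (g x)) = conjc (cint a b g).
Proof.
move=> [r i]; apply: complex_ext; rewrite ?cRe_conj ?cIm_conj /=.
  by apply: eq_rint => x _; rewrite cRe_conj.
rewrite -mulN1r -rintZ//; apply: eq_rint => x _.
by rewrite cIm_conj mulN1r.
Qed.

Lemma cint_czsum a b (h : R -> int -> R[i]) (m : int -> R) : a <= b ->
  l1 m -> (forall x k, a <= x <= b -> normc (h x k) <= m k) ->
  (forall k, ccont (h^~ k)) -> ccont (fun x => czsum (h x)) ->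
  cint a b (fun x => czsum (h x)) = czsum (fun k => cint a b (h^~ k)).
Proof.
move=> ab lm hm ch [cr ci].
apply: complex_ext; rewrite /= (rint_zsum ab lm)//.
- by move=> x k xab; rewrite (le_trans (normc_Re _))// hm.
- by move=> k; exact: (ch k).1.
- by move=> x k xab; rewrite (le_trans (normc_Im _))// hm.
- by move=> k; exact: (ch k).2.
Qed.

End Integrals.
Arguments psum_continuous {R T h} n.
Arguments rint_integrable {R} a b {f}.

(** * Complex exponentials and limits of complex functions *)

Section Exponential.
Context {R : realType}.
Implicit Types (x y t : R).

Lemma expiD x y : expi (x + y) = expi x * expi y :> R[i].
Proof. by apply: complex_ext; rewrite /= ?cosD ?sinD// addrC. Qed.

Lemma expi0 : expi 0 = 1 :> R[i].
Proof. by rewrite /expi cos0 sin0. Qed.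

Lemma normc_expi x : normc (expi x) = 1.
Proof. by rewrite /= cos2Dsin2 sqrtr1. Qed.

Lemma conj_expi x : conjc (expi x) = expi (- x).
Proof. by rewrite /expi cosN sinN. Qed.

Lemma ccont_expi : ccont (@expi R).
Proof. by split; [exact: continuous_cos|exact: continuous_sin]. Qed.

Lemma continuous_mull x : continuous (fun t => x * t).
Proof. by move=> t; apply: cvgM; [exact: cvg_cst|exact: cvg_id]. Qed.

Lemma normc_continuous (g : R -> R[i]) : ccont g -> continuous (fun t => normc (g t)).
Proof.
move=> [r i]; rewrite (_ : (fun t => _) =
  fun t => Num.sqrt (complex.Re (g t) ^+ 2 + complex.Im (g t) ^+ 2)); last first.
  by apply/funext => t; case: (g t).
move=> t; apply: continuous_cvg; first exact: sqrt_continuous.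
by apply: cvgD; apply: cvgM; [exact: r|exact: r|exact: i|exact: i].
Qed.

End Exponential.

(** Increments that telescope against a convergent sequence [y] force convergence,
    with the same telescoping control of the distance to the limit. *)
Lemma normc_clim_le (R : realType) (z : nat -> R[i]) (y : nat -> R) (Y : R) n :
  (forall i, normc (z i.+1 - z i) <= y i.+1 - y i) -> y i @[i --> \oo] --> Y ->
  normc ((limn (fun i => complex.Re (z i)) +i*
          limn (fun i => complex.Im (z i)))%C - z n) <= Y - y n.
Proof.
move=> zy yY.
have ynd : nondecreasing_seq y.
  by apply/nondecreasing_seqP => i; rewrite -subr_ge0 (le_trans _ (zy i)) ?normc_ge0.
have yle i : y i <= Y.
  by rewrite -(cvg_lim _ yY)// nondecreasing_cvgn_le//; apply/cvg_ex; exists Y.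
have zdist i p : (i <= p)%N -> normc (z p - z i) <= y p - y i.
  elim: p => [|p IH]; first by rewrite leqn0 => /eqP ->; rewrite !subrr Normc.normc0.
  rewrite leq_eqVlt => /predU1P[->|/IH{}IH]; first by rewrite !subrr Normc.normc0.
  rewrite -(subrK (z p) (z p.+1)) -addrA (le_trans (le_normcD _ _))//.
  by rewrite -(subrK (y p) (y p.+1)) -[leRHS]addrA lerD.
have cvgx (x : nat -> R) : (forall i, `|x i.+1 - x i| <= y i.+1 - y i) ->
    (forall i, `|x i - x 0%N| <= y i - y 0%N) -> cvgn x.
  move=> xs x0; have xE : x = (x \+ y) \- y by apply/funext => i /=; rewrite addrK.
  rewrite xE; apply: is_cvgB; last by apply/cvg_ex; exists Y.
  apply: nondecreasing_is_cvgn.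
    apply/nondecreasing_seqP => i /=; have := xs i.
    by rewrite ler_norml => /andP[h _]; lra.
  exists (x 0%N + (Y - y 0%N) + Y) => _ [i _ <-] /=.
  by have := x0 i; have := yle i; rewrite ler_norml => h /andP[_ h']; lra.
have cRe : cvgn (fun i => complex.Re (z i)).
  apply: cvgx => i; rewrite -cReN -cReD (le_trans (normc_Re _))//.
  exact: zdist.
have cIm : cvgn (fun i => complex.Im (z i)).
  apply: cvgx => i; rewrite -cImN -cImD (le_trans (normc_Im _))//.
  exact: zdist.
apply: normc_le_dot => a b ab; rewrite cReD cImD cReN cImN /=.
have h1 : a * (complex.Re (z i) - complex.Re (z n)) +
    b * (complex.Im (z i) - complex.Im (z n)) @[i --> \oo] -->
  a * (limn (fun i => complex.Re (z i)) - complex.Re (z n)) +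
    b * (limn (fun i => complex.Im (z i)) - complex.Im (z n)).
  by apply: cvgD; apply: cvgM; [exact: cvg_cst| |exact: cvg_cst|];
    apply: cvgB => //; exact: cvg_cst.
have h2 : y i - y n @[i --> \oo] --> Y - y n.
  by apply: cvgB => //; exact: cvg_cst.
apply: (ler_cvg_to h1 h2); exists n => // i /= ni.
apply: le_trans (zdist _ _ ni); rewrite -cReN -cImN -cReD -cImD.
exact: normc_dot.
Qed.

Lemma ccont_ulim (R : realType) (z : nat -> R -> R[i]) (l : R -> R[i]) (e : nat -> R) :
  (forall n, ccont (z n)) -> (forall n t, normc (l t - z n t) <= e n) ->
  e n @[n --> \oo] --> (0 : R) -> ccont l.
Proof.
move=> cz lz e0.
have ulim (g : nat -> R -> R) (h : R -> R) : (forall n, continuous (g n)) ->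
    (forall n t, `|h t - g n t| <= e n) -> continuous h.
  move=> cg hg t; apply/cvgrPdist_lt => d d0.
  have d3 : 0 < d / 3 by lra.
  move/cvgrPdist_lt : e0 => /(_ _ d3)[n _ /(_ n (leqnn n))].
  rewrite sub0r normrN => /(le_lt_trans (ler_norm _)) en.
  have /cvgrPdist_lt/(_ _ d3) := cg n t.
  apply: filterS => s gs.
  rewrite (_ : h t - h s = (h t - g n t) + ((g n t - g n s) - (h s - g n s)));
    last by ring.
  have := hg n t; have := hg n s; move: gs.
  rewrite !ltr_norml !ler_norml => /andP[? ?] /andP[? ?] /andP[? ?].
  by apply/andP; split; lra.
split.
  apply: (ulim (fun n t => complex.Re (z n t))) => [n|n t]; first exact: (cz n).1.
  by rewrite -cReN -cReD (le_trans (normc_Re _)).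
apply: (ulim (fun n t => complex.Im (z n t))) => [n|n t]; first exact: (cz n).2.
by rewrite -cImN -cImD (le_trans (normc_Im _)).
Qed.

(** * The running supremum of a continuous function *)

Section RunningSup.
Context {R : realType}.
Variables (g : R -> R) (B : R).
Hypotheses (cg : continuous g) (gB : forall t, g t <= B).
Implicit Types (s t T : R).

Definition running_sup (f : R -> R) T : R := sup [set f t | t in [set t | t <= T]].

Let has_sup_g T : has_sup [set g t | t in [set t | t <= T]].
Proof.
split; first by exists (g T); exists T => //=.
by exists B => _ [t _ <-].
Qed.

Lemma running_sup_ge t T : t <= T -> g t <= running_sup g T.
Proof.
by move=> tT; apply: ub_le_sup; [have [] := has_sup_g T|exists t].
Qed.

Lemma running_sup_le A T : (forall t, t <= T -> g t <= A) -> running_sup g T <= A.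
Proof.
move=> gA; apply: ge_sup; first by have [] := has_sup_g T.
by move=> _ [t /= tT <-]; exact: gA.
Qed.

Lemma running_sup_continuous : continuous (running_sup g).
Proof.
move=> T; apply/cvgrPdist_le => e e0.
have e2 : 0 < e / 2 by lra.
have nd s t : s <= t -> running_sup g s <= running_sup g t.
  by move=> st; apply: running_sup_le => r rs; apply: running_sup_ge; exact: le_trans st.
have /cvgrPdist_le/(_ _ e2)/nbhs_ballP[d /= d0 gd] := @cg T.
have near_g s : `|T - s| < d -> g T - e / 2 <= g s <= g T + e / 2.
  by move=> /gd; rewrite ler_norml => /andP[? ?]; apply/andP; split; lra.
(* beyond s only values within e / 2 of g T occur before t *)
have step s t : `|T - s| < d -> `|T - t| < d -> s <= t ->
    running_sup g t <= running_sup g s + e.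
  move=> sd td st; apply: running_sup_le => r rt.
  have [rs|sr] := leP r s.
    by rewrite (le_trans (running_sup_ge rs))// lerDl ltW.
  have rd : `|T - r| < d.
    by move: sd td; rewrite !ltr_norml => /andP[? ?] /andP[? ?]; apply/andP; split; lra.
  have /andP[_ h1] := near_g r rd; have /andP[h2 _] := near_g s sd.
  by have := running_sup_ge (lexx s); lra.
apply/nbhs_ballP; exists d => //= s sd.
have TT : `|T - T| < d by rewrite subrr normr0.
have [Ts|/ltW sT] := leP T s.
  by have := step T s TT sd Ts; have := nd _ _ Ts; rewrite ler_norml => ? ?;
    apply/andP; split; lra.
by have := step s T sd TT sT; have := nd _ _ sT; rewrite ler_norml => ? ?;
  apply/andP; split; lra.
Qed.

End RunningSup.

(** * The quadratic mild problem on Fourier coefficients *)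

Section MildProblem.
Context {R : realType}.
Implicit Types (t s T : R) (k j : int) (c d : int -> R -> R[i]) (m p : int -> R).

Definition nabs k : R := (`|k|%N)%:R.

Lemma nabs_ge0 k : 0 <= nabs k. Proof. exact: ler0n. Qed.

Lemma nabsD k j : nabs (k + j) <= nabs k + nabs j.
Proof. by rewrite /nabs -natrD ler_nat; lia. Qed.

Variables (rho theta : int -> R) (q : int -> int -> R[i]) (varpi C : R).
Hypothesis rho_ge : forall k, nabs k <= rho k.
Hypothesis varpi01 : 0 < varpi < 1.
Hypothesis C_gt0 : 0 < C.
Hypothesis q_le : forall k j, normc (q k j) <= C * nabs k.

Definition weight t k : R := expR (- (varpi * t * nabs k)).

Definition propagator t k : R[i] :=
  (expR (- (t * rho k)))%:C%C * expi (- (t * theta k)).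

Definition quad (f g : int -> R[i]) k : R[i] :=
  czsum (fun j => q k j * (f j * g (k - j))).

Lemma weight_gt0 t k : 0 < weight t k. Proof. exact: expR_gt0. Qed.

Lemma weight_le1 t k : 0 <= t -> weight t k <= 1.
Proof.
move=> t0; rewrite /weight -expR0 ler_expR oppr_le0 !mulr_ge0 ?nabs_ge0//.
by case/andP: varpi01 => /ltW.
Qed.

(** The weight is submultiplicative along [k = j + (k - j)], so that weighted
    bounds survive convolution. *)
Lemma weightM t k j : 0 <= t -> weight t j * weight t (k - j) <= weight t k.
Proof.
move=> t0; rewrite /weight -expRD ler_expR -opprD -mulrDr lerN2.
rewrite ler_wpM2l ?mulr_ge0//; first by case/andP: varpi01 => /ltW.
by have := nabsD (k - j) j; rewrite subrK addrC.
Qed.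

Lemma normc_propagator t k : normc (propagator t k) = expR (- (t * rho k)).
Proof.
by rewrite Normc.normcM normc_real normc_expi mulr1 ger0_norm// expR_ge0.
Qed.

Lemma propagatorD t s k : propagator (t + s) k = propagator t k * propagator s k.
Proof.
rewrite /propagator !mulrDl !opprD expRD expiD rmorphM /=.
by rewrite mulrACA.
Qed.

Lemma ccont_propagator k : ccont (propagator^~ k).
Proof.
apply: ccontM.
  apply: ccont_real => t; apply: continuous_cvg; first exact: continuous_expR.
  by apply: cvgN; apply: cvgM; [exact: cvg_id|exact: cvg_cst].
apply: (@ccont_comp _ expi (fun t => - (t * theta k))); first exact: ccont_expi.
by move=> t; apply: cvgN; apply: cvgM; [exact: cvg_id|exact: cvg_cst].
Qed.

Lemma propagator_weight t k : 0 <= t -> expR (- (t * rho k)) <= weight t k.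
Proof.
move=> t0; rewrite ler_expR lerN2 (mulrC varpi) -mulrA ler_wpM2l//.
case/andP: varpi01 => v0 v1; apply: le_trans (rho_ge k).
by rewrite ler_piMl ?nabs_ge0// ltW.
Qed.

Lemma cl1_quad (f g : int -> R[i]) k : cl1 f -> cl1 g ->
  cl1 (fun j => q k j * (f j * g (k - j))).
Proof.
move=> lf lg.
apply: (cl1_le (@l1Z _ (C * nabs k) _ (l1_conv_term k lf lg))) => j.
by rewrite !Normc.normcM ler_wpM2r// mulr_ge0 ?normc_ge0.
Qed.

Arguments cl1_quad {f g} k.

Lemma quad_weight (f g : int -> R[i]) m p t k : 0 <= t -> l1 m -> l1 p ->
  (forall j, normc (f j) <= m j * weight t j) ->
  (forall j, normc (g j) <= p j * weight t j) ->
  normc (quad f g k) <= C * nabs k * conv m p k * weight t k.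
Proof.
move=> t0 lm lp fm gp.
have m0 j : 0 <= m j.
  rewrite -(pmulr_lge0 _ (weight_gt0 t j)).
  exact: le_trans (normc_ge0 _) (fm j).
have p0 j : 0 <= p j.
  rewrite -(pmulr_lge0 _ (weight_gt0 t j)).
  exact: le_trans (normc_ge0 _) (gp j).
have lf : cl1 f.
  by apply: cl1_le lm _ => j; rewrite (le_trans (fm j))// ler_piMr ?weight_le1.
have lg : cl1 g.
  by apply: cl1_le lp _ => j; rewrite (le_trans (gp j))// ler_piMr ?weight_le1.
have lq := cl1_quad k lf lg.
apply: (le_trans (normc_czsum lq)).
rewrite mulrAC /conv -zsumZ; last exact: l1_conv_term.
apply: le_zsum => // [|j]; first by apply: l1Z; exact: l1_conv_term.
rewrite !Normc.normcM -[leRHS]mulrA ler_pM ?mulr_ge0 ?normc_ge0//.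
apply: (@le_trans _ _ (m j * weight t j * (p (k - j) * weight t (k - j)))).
  by rewrite ler_pM ?normc_ge0.
by rewrite mulrACA mulrC ler_wpM2r ?mulr_ge0// weightM.
Qed.

(** Polarisation of a difference of squares, the source of all contraction
    estimates. *)
Lemma quadB (f g : int -> R[i]) k : cl1 f -> cl1 g ->
  quad f f k - quad g g k =
  quad (fun j => f j - g j) f k + quad g (fun j => f j - g j) k.
Proof.
move=> lf lg; have lB : cl1 (fun j => f j - g j) by apply: cl1D => //; exact: cl1N.
have lff := cl1_quad k lf lf; have lgg := cl1_quad k lg lg.
have lBf := cl1_quad k lB lf; have lgB := cl1_quad k lg lB.
rewrite /quad -czsumD//.
apply/eqP; rewrite subr_eq; apply/eqP; rewrite -czsumD//.
  by congr czsum; apply/funext => j; ring.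
exact: cl1D.
Qed.

(** Coefficients of a function of the space-time class with majorant [m].  Times
    are clipped at 0 so that continuity can be asked on the whole line. *)
Definition trajectory m c : Prop :=
  [/\ l1 m, forall k, ccont (c k), forall k t, c k t = c k (Num.max 0 t) &
      forall k t, 0 <= t -> normc (c k t) <= m k * weight t k].

Lemma traj_ge0 m c k : trajectory m c -> 0 <= m k.
Proof.
move=> [_ _ _ /(_ k 0 (lexx _))]; rewrite /weight mulr0 mul0r oppr0 expR0 mulr1.
exact: le_trans (normc_ge0 _).
Qed.

Arguments traj_ge0 {m c} k.

Lemma traj_le m c k t : trajectory m c -> normc (c k t) <= m k.
Proof.
move=> tc; have m0 := traj_ge0 k tc; case: tc => [_ _ -> cm].
have t0 : 0 <= Num.max 0 t by rewrite le_max lexx.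
by rewrite (le_trans (cm _ _ t0))// ler_piMr ?weight_le1.
Qed.

Arguments traj_le {m c} k t.

Lemma traj_cl1 m c t : trajectory m c -> cl1 (c^~ t).
Proof.
by move=> tc; have [lm _ _ _] := tc; apply: cl1_le lm _ => k; exact: traj_le.
Qed.

Lemma traj_quad m p c d k : trajectory m c -> trajectory p d ->
  ccont (fun t => quad (c^~ t) (d^~ t) k).
Proof.
move=> tc td; have [lm cc _ _] := tc; have [lp cd _ _] := td.
have ct j : ccont (fun t => q k j * (c j t * d (k - j) t)).
  by apply: ccontM; [exact: ccont_cst|exact: ccontM].
have bd t j : normc (q k j * (c j t * d (k - j) t)) <=
    C * nabs k * (m j * p (k - j)).
  rewrite !Normc.normcM ler_pM ?mulr_ge0 ?normc_ge0//.
  by rewrite ler_pM ?normc_ge0 ?(traj_le _ _ tc) ?(traj_le _ _ td).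
have lb := @l1Z _ (C * nabs k) _ (l1_conv_term k lm lp).
split; apply: (zsum_continuous lb) => [t j|j].
- exact: le_trans (normc_Re _) (bd t j).
- exact: (ct j).1.
- exact: le_trans (normc_Im _) (bd t j).
- exact: (ct j).2.
Qed.

Arguments traj_quad {m p c d} k.

Lemma trajB m p c d : trajectory m c -> trajectory p d ->
  trajectory (fun k => m k + p k) (fun k t => c k t - d k t).
Proof.
move=> [lm cc ec cm] [lp cd ed dm]; split.
- exact: l1D.
- by move=> k; apply: ccontD => //; exact: ccontN.
- by move=> k t; rewrite ec ed.
- move=> k t t0; rewrite mulrDl (le_trans (le_normcD _ _))// normcN.
  by rewrite lerD ?cm ?dm.
Qed.

(** The integral of [propagator (t - s)] against the quadratic term, with the factor
    depending on [t] pulled out; in this form continuity in [t] is immediate. *)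
Definition duhamel_integral c d k t : R[i] :=
  propagator (Num.max 0 t) k *
    cint 0 (Num.max 0 t) (fun s => propagator (- s) k * quad (c^~ s) (d^~ s) k).

Lemma ccont_integrand m p c d k : trajectory m c -> trajectory p d ->
  ccont (fun s => propagator (- s) k * quad (c^~ s) (d^~ s) k).
Proof.
move=> tc td; apply: ccontM; last exact: traj_quad tc td.
apply: (@ccont_comp _ (propagator^~ k) (fun s => - s)).
  exact: ccont_propagator.
by move=> t; apply: cvgN; exact: cvg_id.
Qed.

Arguments ccont_integrand {m p c d} k.

Lemma max0_continuous : continuous (fun t => Num.max 0 t).
Proof. by move=> t; apply: continuous_max; [exact: cvg_cst|exact: cvg_id]. Qed.

Lemma ccont_duhamel m p c d k : trajectory m c -> trajectory p d ->
  ccont (duhamel_integral c d k).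
Proof.
move=> tc td; have [cr ci] := ccont_integrand k tc td.
apply: ccontM.
  by apply: (@ccont_comp _ (propagator^~ k)); [exact: ccont_propagator|
    exact: max0_continuous].
by split; exact: rint_primitive_continuous.
Qed.

Lemma duhamelE m p c d k t : 0 <= t -> trajectory m c -> trajectory p d ->
  duhamel_integral c d k t =
  cint 0 t (fun s => propagator (t - s) k * quad (c^~ s) (d^~ s) k).
Proof.
move=> t0 tc td; rewrite /duhamel_integral max_r// -cintZ.
  by apply: eq_cint => s _; rewrite propagatorD mulrA.
exact: ccont_integrand tc td.
Qed.

Arguments duhamelE {m p c d} k {t}.

Lemma duhamelB m p c d k t : trajectory m c -> trajectory p d ->
  duhamel_integral c c k t - duhamel_integral d d k t =
  duhamel_integral (fun k t => c k t - d k t) c k t +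
  duhamel_integral d (fun k t => c k t - d k t) k t.
Proof.
move=> tc td; have tB := trajB tc td.
rewrite /duhamel_integral; move: (propagator (Num.max 0 t) k) => P.
rewrite -mulrBr -mulrDr; congr (P * _).
have i1 := ccont_integrand k tc tc; have i2 := ccont_integrand k td td.
have i3 := ccont_integrand k tB tc; have i4 := ccont_integrand k td tB.
apply/eqP; rewrite subr_eq -!cintD//; last exact: ccontD.
apply/eqP/eq_cint => s _; rewrite -!mulrDr; congr (_ * _).
by rewrite -quadB ?subrK//; [exact: traj_cl1 tc|exact: traj_cl1 td].
Qed.

Definition gain : R := C / (1 - varpi).

Lemma gain_gt0 : 0 < gain.
Proof. by rewrite divr_gt0// subr_gt0; case/andP: varpi01. Qed.

(** The smoothing estimate.  Writing the propagator bound
    [e^(- (t - s) |k|)] as [e^(- varpi (t - s) |k|) e^(- (1 - varpi) (t - s) |k|)],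
    the first factor restores the weight at time [t], and the second, times the
    factor [|k|] of the kernel, has integral at most [1 / (1 - varpi)].  Bounds on
    [[0, T]] suffice, which the uniqueness argument exploits. *)
Lemma duhamel_le m p c d m1 p1 T k t : trajectory m1 c -> trajectory p1 d ->
  l1 m -> l1 p ->
  (forall j s, 0 <= s <= T -> normc (c j s) <= m j * weight s j) ->
  (forall j s, 0 <= s <= T -> normc (d j s) <= p j * weight s j) ->
  0 <= t <= T ->
  normc (duhamel_integral c d k t) <= gain * conv m p k * weight t k.
Proof.
move=> tc td lm lp cm dp /andP[t0 tT]; rewrite (duhamelE k t0 tc td).
have /andP[v0 v1] := varpi01; have v10 : 1 - varpi != 0 by rewrite subr_eq0 gt_eqF.
have m0 j : 0 <= m j.
  have := cm j 0; rewrite lexx (le_trans t0 tT) => /(_ isT) /(le_trans (normc_ge0 _)).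
  by rewrite pmulr_lge0 ?weight_gt0.
have p0 j : 0 <= p j.
  have := dp j 0; rewrite lexx (le_trans t0 tT) => /(_ isT) /(le_trans (normc_ge0 _)).
  by rewrite pmulr_lge0 ?weight_gt0.
have cv0 : 0 <= conv m p k by exact: conv_ge0.
pose b := (1 - varpi) * nabs k; pose A := gain * conv m p k * weight t k.
have b0 : 0 <= b by rewrite mulr_ge0 ?nabs_ge0// subr_ge0 ltW.
have A0 : 0 <= A by exact: mulr_ge0 (mulr_ge0 (ltW gain_gt0) cv0) (ltW (weight_gt0 _ _)).
(* an explicit antiderivative of the exponential bound on the integrand *)
have dF s : is_derive s 1 (fun s => A * expR (- (b * (t - s))))
    (A * (b * expR (- (b * (t - s))))).
  apply: is_derive_eq; rewrite /GRing.scale /=; ring.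
have cf : continuous (fun s => A * (b * expR (- (b * (t - s))))).
  move=> s; apply: cvgM; first exact: cvg_cst.
  apply: cvgM; first exact: cvg_cst.
  apply: continuous_cvg; first exact: continuous_expR.
  apply: cvgN; apply: cvgM; first exact: cvg_cst.
  by apply: cvgB; [exact: cvg_cst|exact: cvg_id].
apply: (@le_trans _ _ (rint 0 t (fun s => A * (b * expR (- (b * (t - s))))))).
  apply: normc_cint => //.
    apply: ccontM; last exact: traj_quad tc td.
    apply: (@ccont_comp _ (propagator^~ k) (fun s => t - s)).
      exact: ccont_propagator.
    by move=> s; apply: cvgB; [exact: cvg_cst|exact: cvg_id].
  move=> s /andP[s0 st]; have sT : 0 <= s <= T by rewrite s0 (le_trans st).
  rewrite Normc.normcM normc_propagator.
  have qw := @quad_weight (c^~ s) (d^~ s) m p s k s0 lm lp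
    (fun j => cm j s sT) (fun j => dp j s sT).
  apply: (@le_trans _ _ (expR (- ((t - s) * nabs k)) *
      (C * nabs k * conv m p k * weight s k))).
    rewrite ler_pM ?expR_ge0 ?normc_ge0// ler_expR lerN2 ler_wpM2l// subr_ge0//.
  rewrite le_eqVlt; apply/orP; left; apply/eqP.
  rewrite (_ : expR (- ((t - s) * nabs k)) * (C * nabs k * conv m p k * weight s k) =
    C * nabs k * conv m p k * (expR (- ((t - s) * nabs k)) * weight s k)); last by ring.
  rewrite (_ : A * _ = C * nabs k * conv m p k * (weight t k * expR (- (b * (t - s)))));
    last by rewrite /A /b /gain; field.
  congr (_ * _); rewrite /weight -!expRD; congr expR; rewrite /b; ring.
rewrite (rint_FTC t0 cf dF) subrr mulr0 oppr0 expR0 mulr1 gerBl.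
by rewrite mulr_ge0// expR_ge0.
Qed.

Variable c0 : int -> R[i].
Hypothesis lc0 : cl1 c0.
Let W0 : R := zsum (fun k => normc (c0 k)).
Hypothesis small : 4 * gain * W0 < 1.

Definition duhamel_map c k t : R[i] :=
  propagator (Num.max 0 t) k * c0 k + duhamel_integral c c k t.

(** The scalar counterpart of [duhamel_map]. *)
Definition next_majorant m k : R := normc (c0 k) + gain * conv m m k.

Lemma W0_ge0 : 0 <= W0.
Proof. by apply: zsum_ge0 => // k; exact: normc_ge0. Qed.

Lemma duhamel_map_le m c m1 T k t : trajectory m1 c -> l1 m ->
  (forall j s, 0 <= s <= T -> normc (c j s) <= m j * weight s j) ->
  0 <= t <= T ->
  normc (duhamel_map c k t) <= next_majorant m k * weight t k.
Proof.
move=> tc lm cm tT; have /andP[t0 _] := tT.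
rewrite /next_majorant mulrDl (le_trans (le_normcD _ _))// lerD//.
  rewrite max_r// Normc.normcM mulrC ler_wpM2l ?normc_ge0//.
  by rewrite normc_propagator propagator_weight.
exact: (duhamel_le k tc tc lm lm cm cm tT).
Qed.

Lemma l1_next_majorant m : l1 m -> (forall k, 0 <= m k) ->
  [/\ l1 (next_majorant m), forall k, 0 <= next_majorant m k &
      zsum (next_majorant m) <= W0 + gain * zsum m ^+ 2].
Proof.
move=> lm m0; have [lc cle] := l1_conv lm lm m0 m0.
have lg := @l1Z _ gain _ lc.
split.
- exact: l1D.
- move=> k; apply: addr_ge0; first exact: normc_ge0.
  by apply: mulr_ge0; [exact: ltW gain_gt0|exact: conv_ge0].
- by rewrite zsumD// zsumZ// lerD2l ler_wpM2l ?(ltW gain_gt0).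
Qed.

Lemma traj_duhamel_map m c : trajectory m c ->
  trajectory (next_majorant m) (duhamel_map c).
Proof.
move=> tc; have [lm cc ec cm] := tc.
have m0 k := traj_ge0 k tc.
split.
- by have [] := l1_next_majorant lm m0.
- move=> k; apply: ccontD; last exact: (ccont_duhamel k tc tc).
  apply: ccontM; last exact: ccont_cst.
  by apply: (@ccont_comp _ (propagator^~ k)); [exact: ccont_propagator|
    exact: max0_continuous].
- move=> k t; have maxK : Num.max 0 (Num.max 0 t) = Num.max 0 t.
    by rewrite maxA maxxx.
  by rewrite /duhamel_map /duhamel_integral maxK.
- move=> k t t0.
  apply: (@duhamel_map_le m c m t k t tc lm); last by rewrite t0 lexx.
  by move=> j s /andP[s0 _]; exact: cm.
Qed.

Fixpoint majorant n : int -> R :=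
  if n is n'.+1 then next_majorant (majorant n') else fun=> 0.

Fixpoint picard n : int -> R -> R[i] :=
  if n is n'.+1 then duhamel_map (picard n') else fun _ _ => 0.

(** The mass stays below [2 W0]: if [X <= 2 W0] then
    [W0 + gain X^2 <= W0 + 4 gain W0^2 <= 2 W0]. *)
Lemma majorant_l1 n : [/\ l1 (majorant n), forall k, 0 <= majorant n k &
  zsum (majorant n) <= 2 * W0].
Proof.
have W00 := W0_ge0; have g0 := gain_gt0.
elim: n => [|n [ln n0 nW]] /=.
  by split => //; [exact: l1_0|rewrite zsum0 mulr_ge0].
have [l' m' z'] := l1_next_majorant ln n0; split => //.
apply: le_trans z' _; have z0 := zsum_ge0 ln n0.
have : zsum (majorant n) ^+ 2 <= (2 * W0) ^+ 2 by rewrite lerXn2r ?nnegrE ?mulr_ge0.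
move=> /(ler_wpM2l (ltW g0)) h.
have h4 : 4 * gain * W0 * W0 <= W0 by rewrite ler_piMl// ltW.
rewrite (_ : gain * (2 * W0) ^+ 2 = 4 * gain * W0 * W0) in h; last by ring.
lra.
Qed.

Lemma majorant_nd n k : majorant n k <= majorant n.+1 k.
Proof.
elim: n k => [|n IH] k.
  by have [_ h _] := majorant_l1 1; exact: h.
rewrite /= /next_majorant lerD2l ler_wpM2l ?(ltW gain_gt0)//.
have [l1n n0 _] := majorant_l1 n; have [l1n1 _ _] := majorant_l1 n.+1.
by apply: le_conv => // j; rewrite n0 IH.
Qed.

Definition limit_majorant k : R := limn (majorant^~ k).

Lemma majorant_cvg k : majorant n k @[n --> \oo] --> limit_majorant k.
Proof.
apply: nondecreasing_is_cvgn.
  by apply/nondecreasing_seqP => n; exact: majorant_nd.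
exists (2 * W0) => _ [n _ <-]; have [ln n0 nW] := majorant_l1 n.
apply: le_trans nW; rewrite -(ger0_norm (n0 k)) (le_trans (l1_term k ln))//.
by apply: le_zsum => //; [exact/l1_norm|move=> j; rewrite ger0_norm].
Qed.

Lemma majorant_le n k : majorant n k <= limit_majorant k.
Proof.
apply: nondecreasing_cvgn_le; last exact: majorant_cvg.
by apply/nondecreasing_seqP => i; exact: majorant_nd.
Qed.

Lemma limit_majorant_ge0 k : 0 <= limit_majorant k.
Proof. exact: majorant_le 0%N k. Qed.

Lemma l1_limit_majorant : l1 limit_majorant.
Proof.
apply: (proj1 (@nneg_l1P _ _ (2 * W0) limit_majorant_ge0 _)) => n.
have cp : psum (majorant i) n @[i --> \oo] --> psum limit_majorant n.
  by apply: cvg_psum_fin => k; exact: majorant_cvg.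
rewrite -(cvg_lim _ cp)//; apply: limr_le; first by apply/cvg_ex; eexists; exact: cp.
by apply: nearW => i; have [li i0 iW] := majorant_l1 i;
  rewrite (le_trans (psum_le_zsum n li i0)).
Qed.

Lemma traj_picard n : trajectory (majorant n) (picard n).
Proof.
elim: n => [|n IH]; last exact: traj_duhamel_map.
split => // [|k|k t _]; first exact: l1_0.
  exact: ccont_cst.
by rewrite [picard _ _ _]/(0 : R[i]) Normc.normc0 mul0r.
Qed.

Lemma conv_diff m p k : l1 m -> l1 p ->
  conv p p k - conv m m k =
  conv (fun j => p j - m j) p k + conv m (fun j => p j - m j) k.
Proof.
move=> lm lp; have lB := l1B lp lm.
have e1 := convDl k lB lm lp; have e2 := convDr k lB lm lm.
have pE : (fun j => p j - m j + m j) = p by apply/funext => j; rewrite subrK.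
rewrite pE in e1 e2.
by rewrite e1 e2 addrA addrK.
Qed.

(** The same polarisation splits the increment of the iterates and that of the
    majorants, so one dominates the other term by term. *)
Lemma picard_step n k t : 0 <= t ->
  normc (picard n.+1 k t - picard n k t) <=
  (majorant n.+1 k - majorant n k) * weight t k.
Proof.
elim: n k t => [|n IH] k t t0.
  by have [_ _ _ /(_ k t t0)] := traj_picard 1; rewrite /= !subr0.
have tn := traj_picard n; have tn1 := traj_picard n.+1.
have [ln _ _ hn] := tn; have [ln1 _ _ hn1] := tn1.
have tB := trajB tn1 tn.
have lB := l1B ln1 ln.
have -> : picard n.+2 k t - picard n.+1 k t =
    duhamel_map (picard n.+1) k t - duhamel_map (picard n) k t by [].
have -> : majorant n.+2 k - majorant n.+1 k =
    next_majorant (majorant n.+1) k - next_majorant (majorant n) k by [].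
rewrite {1 2}/duhamel_map opprD addrACA subrr add0r.
rewrite (duhamelB k t tn1 tn) /next_majorant opprD addrACA subrr add0r -mulrBr.
rewrite conv_diff// mulrDr mulrDl.
have tt : 0 <= t <= t by rewrite t0 lexx.
apply: le_trans (le_normcD _ _) (lerD _ _).
  apply: (duhamel_le k tB tn1 lB ln1 _ _ tt) => j s /andP[s0 _]; first exact: IH.
  exact: hn1.
apply: (duhamel_le k tn tB ln lB _ _ tt) => j s /andP[s0 _]; last exact: IH.
exact: hn.
Qed.

Definition mild k t : R[i] :=
  (limn (fun n => complex.Re (picard n k t)) +i*
   limn (fun n => complex.Im (picard n k t)))%C.

Lemma mild_near n k t : 0 <= t ->
  normc (mild k t - picard n k t) <= (limit_majorant k - majorant n k) * weight t k.
Proof.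
move=> t0; rewrite mulrBl.
apply: (normc_clim_le (z := fun n => picard n k t)
  (y := fun n => majorant n k * weight t k)).
  by move=> i; rewrite -mulrBl; exact: picard_step.
by apply: cvgM; [exact: majorant_cvg|exact: cvg_cst].
Qed.

Lemma mild_max k t : mild k t = mild k (Num.max 0 t).
Proof.
by congr Complex; congr (limn _); apply/funext => n;
  have [_ _ -> _] := traj_picard n.
Qed.

Lemma traj_mild : trajectory limit_majorant mild.
Proof.
split; first exact: l1_limit_majorant.
- move=> k; apply: (@ccont_ulim _ (fun n => picard n k) _
    (fun n => limit_majorant k - majorant n k)).
  + by move=> n; have [] := traj_picard n.
  + move=> n t; have [_ _ -> _] := traj_picard n; rewrite mild_max.
    have m0 : 0 <= Num.max 0 t by rewrite le_max lexx.
    rewrite (le_trans (mild_near n k m0))// ler_piMr ?weight_le1//.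
    by rewrite subr_ge0 majorant_le.
  + rewrite -(subrr (limit_majorant k)).
    by apply: cvgB; [exact: cvg_cst|exact: majorant_cvg].
- exact: mild_max.
- by move=> k t t0; have := mild_near 0 k t0; rewrite /= !subr0.
Qed.

(** The defect at [mild] is at most a constant times the mass [D n] of
    [limit_majorant - majorant n], which tends to 0. *)
Lemma mild_fixed k t : 0 <= t -> mild k t = duhamel_map mild k t.
Proof.
move=> t0; have tm := traj_mild; have lmm := l1_limit_majorant.
pose D n := zsum (fun j => limit_majorant j - majorant n j).
have D0 : D n @[n --> \oo] --> (0 : R).
  rewrite -(@zsum0 R); apply: (@zsum_cvg _ _ _ _ _ _ limit_majorant) => //.
  - by move=> j; rewrite normr0 limit_majorant_ge0.
  - apply: nearW => n j; rewrite ger0_norm ?subr_ge0 ?majorant_le//.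
    by rewrite gerBl; have [_ /(_ j)] := majorant_l1 n.
  - move=> j; rewrite -(subrr (limit_majorant j)).
    by apply: cvgB; [exact: cvg_cst|exact: majorant_cvg].
pose L := zsum limit_majorant.
have bound n : normc (mild k t - duhamel_map mild k t) <= (1 + 2 * gain * L) * D n.
  have tn := traj_picard n; have [ln _ _ hn] := tn.
  have [_ n0 _] := majorant_l1 n.
  pose delta j := limit_majorant j - majorant n j.
  have d0 j : 0 <= delta j by rewrite subr_ge0 majorant_le.
  have ld : l1 delta by exact: l1B.
  have Dn0 : 0 <= D n by exact: zsum_ge0.
  have ngL : zsum (majorant n) <= L by apply: le_zsum => // j; exact: majorant_le.
  have tB := trajB tm tn.
  have tt : 0 <= t <= t by rewrite t0 lexx.
  have w1 := weight_le1 k t0; have w0 := ltW (weight_gt0 t k).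
  have g0 := gain_gt0.
  have term p1 p2 : l1 p1 -> l1 p2 -> (forall j, 0 <= p1 j) ->
      (forall j, 0 <= p2 j) -> gain * conv p1 p2 k * weight t k <=
        gain * (zsum p1 * zsum p2).
    move=> lp1 lp2 p10 p20; have [lc lcle] := l1_conv lp1 lp2 p10 p20.
    have cv0 := conv_ge0 k lp1 lp2 p10 p20.
    apply: (@le_trans _ _ (gain * conv p1 p2 k)).
      by rewrite ler_piMr// mulr_ge0// ltW.
    rewrite ler_wpM2l ?(ltW g0)//; apply: le_trans lcle.
    exact: (nneg_term_le k lc (fun j => conv_ge0 j lp1 lp2 p10 p20)).
  have h1 : normc (mild k t - picard n.+1 k t) <= D n.
    apply: le_trans (mild_near n.+1 k t0) _.
    apply: (@le_trans _ _ (delta k)); last exact: (nneg_term_le k ld d0).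
    apply: (@le_trans _ _ (limit_majorant k - majorant n.+1 k)).
      by rewrite ler_piMr// subr_ge0 majorant_le.
    by rewrite lerD2l lerN2 majorant_nd.
  have h2 : normc (duhamel_map mild k t - picard n.+1 k t) <=
      gain * (D n * L) + gain * (L * D n).
    rewrite /= /duhamel_map opprD addrACA subrr add0r (duhamelB k t tm tn).
    apply: le_trans (le_normcD _ _) (lerD _ _).
      apply: le_trans (term _ _ ld lmm d0 limit_majorant_ge0).
      apply: (duhamel_le k tB tm ld lmm _ _ tt) => j s /andP[s0 _].
        exact: mild_near.
      by have [_ _ _ h] := tm; exact: h.
    apply: (@le_trans _ _ (gain * (zsum (majorant n) * D n))); last first.
      by rewrite ler_wpM2l ?(ltW g0)// ler_wpM2r.
    apply: le_trans (term _ _ ln ld n0 d0).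
    apply: (duhamel_le k tn tB ln ld _ _ tt) => j s /andP[s0 _]; last exact: mild_near.
    exact: hn.
  rewrite (_ : _ - _ = (mild k t - picard n.+1 k t) -
    (duhamel_map mild k t - picard n.+1 k t)); last by rewrite opprB addrA subrK.
  rewrite (le_trans (le_normcD _ _))// normcN (le_trans (lerD h1 h2))//.
  by rewrite le_eqVlt; apply/orP; left; apply/eqP; ring.
apply/eqP; rewrite -subr_eq0; apply/eqP/Normc.eq0_normc/eqP.
rewrite eq_le normc_ge0 andbT.
have c0' : (1 + 2 * gain * L) * D n @[n --> \oo] --> (0 : R).
  by rewrite -(mulr0 (1 + 2 * gain * L)); apply: cvgM; [exact: cvg_cst|].
rewrite -(cvg_lim _ c0')//; apply: limr_ge; first by apply/cvg_ex; eexists; exact: c0'.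
by apply: nearW => n; exact: bound.
Qed.

Definition amplitude c k t : R := normc (c k t) / weight (Num.max 0 t) k.

(** The smallest majorant of [c] on [[0, T]]. *)
Definition peak c k T : R := running_sup (amplitude c k) T.

Lemma amplitude_le m c k t : trajectory m c -> amplitude c k t <= m k.
Proof.
move=> [_ _ ec cm]; rewrite ler_pdivrMr ?weight_gt0// ec cm//.
by rewrite le_max lexx.
Qed.

Lemma amplitude_continuous m c k : trajectory m c -> continuous (amplitude c k).
Proof.
move=> [_ cc _ _] t; apply: cvgM; first exact: normc_continuous.
apply: cvgV; first by rewrite gt_eqF// weight_gt0.
apply: continuous_cvg; first exact: continuous_expR.
apply: cvgN; apply: cvgM; last exact: cvg_cst.
by apply: cvgM; [exact: cvg_cst|exact: max0_continuous].
Qed.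

Lemma amplitude_ge0 c k t : 0 <= amplitude c k t.
Proof. by rewrite divr_ge0 ?normc_ge0// ltW// weight_gt0. Qed.

Lemma peak_continuous m c k : trajectory m c -> continuous (peak c k).
Proof.
move=> tc; apply: (@running_sup_continuous _ (amplitude c k) (m k)).
  exact: amplitude_continuous tc.
by move=> t; exact: amplitude_le tc.
Qed.

Lemma peak_ge m c k t T : trajectory m c -> 0 <= t <= T ->
  normc (c k t) <= peak c k T * weight t k.
Proof.
move=> tc /andP[t0 tT]; rewrite -ler_pdivrMr ?weight_gt0//.
rewrite -[X in weight X k](max_r t0).
by apply: (@running_sup_ge _ (amplitude c k) (m k)) => // s; exact: amplitude_le tc.
Qed.

Lemma peak_le m c k T A : trajectory m c -> 0 <= T ->
  (forall t, 0 <= t <= T -> normc (c k t) <= A * weight t k) -> peak c k T <= A.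
Proof.
move=> tc T0 cA; apply: (@running_sup_le _ (amplitude c k) (m k)).
  by move=> s; exact: amplitude_le tc.
move=> t tT; rewrite /amplitude ler_pdivrMr ?weight_gt0//.
have [_ _ -> _] := tc; apply: cA.
by rewrite le_max lexx /= ge_max T0.
Qed.

Lemma peak_bounds m c k T : trajectory m c -> 0 <= peak c k T <= m k.
Proof.
move=> tc; apply/andP; split.
  apply: le_trans (amplitude_ge0 c k T) _.
  by apply: (@running_sup_ge _ (amplitude c k) (m k)) => // s; exact: amplitude_le tc.
apply: (@running_sup_le _ (amplitude c k) (m k)) => [s|s _]; exact: amplitude_le tc.
Qed.

Lemma l1_peak m c T : trajectory m c -> l1 (peak c ^~ T).
Proof.
move=> tc; have [lm _ _ _] := tc; apply: l1_le lm _ => k.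
by have /andP[h1 h2] := peak_bounds k T tc; rewrite ger0_norm.
Qed.

Arguments l1_peak {m c} T.

Definition size_upto c T : R := zsum (peak c ^~ T).

Lemma size_upto_continuous m c : trajectory m c -> continuous (size_upto c).
Proof.
move=> tc; have [lm _ _ _] := tc; apply: (zsum_continuous lm) => [t k|k].
  by have /andP[h1 h2] := peak_bounds k t tc; rewrite ger0_norm.
exact: peak_continuous tc.
Qed.

Lemma size_upto_ge0 m c T : trajectory m c -> 0 <= size_upto c T.
Proof.
move=> tc; apply: zsum_ge0 => [|k]; first exact: l1_peak tc.
by have /andP[] := peak_bounds k T tc.
Qed.

Arguments size_upto_ge0 {m c} T.

Definition mild_coefs c : Prop := forall k t, 0 <= t -> c k t = duhamel_map c k t.

Lemma size_upto_quadratic m c T : trajectory m c -> mild_coefs c -> 0 <= T ->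
  size_upto c T <= W0 + gain * size_upto c T ^+ 2.
Proof.
move=> tc fc T0; have lp := l1_peak T tc.
have p0 k : 0 <= peak c k T by have /andP[] := peak_bounds k T tc.
have [ln _ nle] := l1_next_majorant lp p0; apply: le_trans nle.
apply: le_zsum => // k; apply: (peak_le tc T0) => t tT.
have /andP[t0 _] := tT; rewrite fc//.
by apply: (duhamel_map_le k tc lp _ tT) => j s sT; exact: peak_ge tc sT.
Qed.

(** The inequality [X <= W0 + gain X^2] excludes the value [1 / (2 gain)], which a
    continuous [X] would have to take in order to get from [X 0 <= W0] past it. *)
Lemma size_upto_small m c T : trajectory m c -> mild_coefs c -> 0 <= T ->
  2 * gain * size_upto c T < 1.
Proof.
move=> tc fc T0; have g0 := gain_gt0; have W00 := W0_ge0.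
have X0 : size_upto c 0 <= W0.
  have lp := l1_peak 0 tc; apply: le_zsum => // k.
  apply: (peak_le tc (lexx 0)) => t; rewrite -eq_le => /eqP <-.
  rewrite fc// /duhamel_map /duhamel_integral maxxx /cint !rint_set1 mulr0 addr0.
  rewrite Normc.normcM normc_propagator /weight !(mulr0, mul0r, oppr0) expR0 mul1r mulr1.
  exact: lexx.
rewrite ltNge; apply/negP => h.
have h' : (2 * gain)^-1 <= size_upto c T by rewrite -[leLHS]mulr1 ler_pdivrMl// mulr_gt0.
have hW : W0 < (4 * gain)^-1.
  have g40 : 0 < 4 * gain by rewrite mulr_gt0.
  by rewrite -[ltRHS]mulr1 ltr_pdivlMl.
have ig : (2 * gain)^-1 = 2 * (4 * gain)^-1 by field; rewrite gt_eqF.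
have ig0 : 0 < (4 * gain)^-1 by rewrite invr_gt0 mulr_gt0.
have [s sT Xs] : exists2 s, s \in `[0, T] & size_upto c s = (2 * gain)^-1.
  apply: IVT => //.
    by apply: continuous_subspaceT; exact: (size_upto_continuous tc).
  rewrite ge_min le_max h' orbT andbT.
  by apply/orP; left; rewrite (le_trans X0)// ig; lra.
move: sT; rewrite in_itv /= => /andP[s0 _].
have := size_upto_quadratic tc fc s0; rewrite Xs.
have -> : gain * (2 * gain)^-1 ^+ 2 = (4 * gain)^-1 by field; rewrite gt_eqF.
by rewrite ig; lra.
Qed.

(** The difference of two solutions satisfies [E <= gain (X + Y) E] with both [X] and
    [Y] below [1 / (2 gain)]. *)
Lemma mild_coefs_unique m p c d k t : trajectory m c -> trajectory p d ->
  mild_coefs c -> mild_coefs d -> 0 <= t -> c k t = d k t.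
Proof.
move=> tc td fc fd t0; pose e k t := c k t - d k t.
have tB : trajectory (fun k => m k + p k) e by exact: trajB.
have lc := l1_peak t tc; have ld := l1_peak t td; have le := l1_peak t tB.
have pc0 j : 0 <= peak c j t by have /andP[] := peak_bounds j t tc.
have pd0 j : 0 <= peak d j t by have /andP[] := peak_bounds j t td.
have pe0 j : 0 <= peak e j t by have /andP[] := peak_bounds j t tB.
have Xc := size_upto_small tc fc t0; have Xd := size_upto_small td fd t0.
have [l1c l1c_le] := l1_conv le lc pe0 pc0.
have [l1d l1d_le] := l1_conv ld le pd0 pe0.
have g0 := gain_gt0.
have E_le : size_upto e t <=
    gain * (size_upto e t * size_upto c t) + gain * (size_upto d t * size_upto e t).
  apply: (@le_trans _ _ (zsum (fun j => gain * conv (peak e ^~ t) (peak c ^~ t) j +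
      gain * conv (peak d ^~ t) (peak e ^~ t) j))); last first.
    rewrite zsumD; [|exact: l1Z..]; rewrite !zsumZ//.
    by rewrite lerD// ler_wpM2l// ltW.
  apply: le_zsum => // [|j]; first by apply: l1D; exact: l1Z.
  apply: (peak_le tB t0) => s sT; have /andP[s0 _] := sT.
  rewrite /e fc// fd// /duhamel_map opprD addrACA subrr add0r.
  rewrite (duhamelB j s tc td) mulrDl (le_trans (le_normcD _ _))//.
  apply: lerD.
    by apply: (duhamel_le j tB tc le lc _ _ sT) => i r rT;
      [exact: (@peak_ge _ _ i _ _ tB rT)|exact: (@peak_ge _ _ i _ _ tc rT)].
  by apply: (duhamel_le j td tB ld le _ _ sT) => i r rT;
    [exact: (@peak_ge _ _ i _ _ td rT)|exact: (@peak_ge _ _ i _ _ tB rT)].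
have E0 : size_upto e t = 0.
  have Ege := size_upto_ge0 t tB; apply/eqP; rewrite eq_le Ege andbT leNgt.
  apply/negP => Egt.
  have Xc0 := size_upto_ge0 t tc; have Xd0 := size_upto_ge0 t td.
  have : size_upto e t * (1 - gain * size_upto c t - gain * size_upto d t) <= 0.
    by move: E_le; rewrite -subr_ge0 => E_le; rewrite -oppr_ge0;
      apply: le_trans E_le _; rewrite le_eqVlt; apply/orP; left; apply/eqP; ring.
  by rewrite pmulr_rle0//; lra.
have ek : peak e k t <= 0 by rewrite -E0; exact: (nneg_term_le k le pe0).
have := @peak_ge _ e k t t tB; rewrite t0 lexx => /(_ isT) h.
apply/eqP; rewrite -subr_eq0; apply/eqP/Normc.eq0_normc/eqP.
rewrite eq_le normc_ge0 andbT (le_trans h)//.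
by rewrite pmulr_lle0// weight_gt0.
Qed.

Hypotheses (rhoN : forall k, rho (- k) = rho k)
  (thetaN : forall k, theta (- k) = - theta k)
  (qN : forall k j, q (- k) (- j) = conjc (q k j))
  (c0N : forall k, c0 (- k) = conjc (c0 k)).

(** A fixed point of this involution is the coefficient sequence of a real-valued
    function. *)
Definition conj_reflect c k t : R[i] := conjc (c (- k) t).

Lemma propagatorN t k : propagator t (- k) = conjc (propagator t k).
Proof.
by rewrite /propagator rhoN thetaN mulrN -conj_expi cconjM cconj_real.
Qed.

Lemma quad_reflect (f g : int -> R[i]) k : cl1 f -> cl1 g ->
  quad (fun j => conjc (f (- j))) (fun j => conjc (g (- j))) k =
  conjc (quad f g (- k)).
Proof.
move=> lf lg; rewrite -czsum_conj_refl; last exact: cl1_quad.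
congr czsum; apply/funext => j.
by rewrite !cconjM qN cconjK opprB addrC opprK [- k + j]addrC.
Qed.

Lemma traj_reflect m c : trajectory m c ->
  trajectory (fun k => m (- k)) (conj_reflect c).
Proof.
move=> [lm cc ec cm]; split.
- exact: l1_refl.
- by move=> k; apply: ccont_conj.
- by move=> k t; rewrite /conj_reflect -ec.
- move=> k t t0; rewrite /conj_reflect normc_conj (le_trans (cm _ _ t0))//.
  by rewrite /weight /nabs abszN.
Qed.

Lemma duhamel_map_reflect m c k t : trajectory m c ->
  duhamel_map (conj_reflect c) k t = conj_reflect (duhamel_map c) k t.
Proof.
move=> tc; have tr := traj_reflect tc.
rewrite /conj_reflect /duhamel_map /duhamel_integral cconjD.
rewrite !(cconjM (propagator _ _)) c0N cconjK.
rewrite -!propagatorN !opprK; congr (_ + _ * _).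
rewrite -cint_conj; last exact: (ccont_integrand _ tc tc).
apply: eq_cint => s _; rewrite (cconjM (propagator _ _)) -propagatorN opprK; congr (_ * _).
by apply: quad_reflect; exact: traj_cl1 tc.
Qed.

(** The conjugate reflection of a solution is a solution with the same data, so this
    follows from uniqueness. *)
Lemma mild_hermitian k t : 0 <= t -> mild (- k) t = conjc (mild k t).
Proof.
move=> t0; have tm := traj_mild.
rewrite -[LHS]cconjK; congr conjc.
apply/esym; rewrite -[RHS]/(conj_reflect mild k t).
apply: (mild_coefs_unique k tm (traj_reflect tm)) => //.
  by move=> j s s0; exact: mild_fixed.
by move=> j s s0; rewrite (duhamel_map_reflect _ _ tm) /conj_reflect mild_fixed.
Qed.

(** From [y e^(- y) <= 1] at [y = varpi t |k|]: at positive times the weight absorbs a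
    derivative. *)
Lemma nabs_weight t k : 0 < t -> nabs k * weight t k <= (varpi * t)^-1.
Proof.
move=> t0; have vt : 0 < varpi * t by rewrite mulr_gt0//; case/andP: varpi01.
rewrite -[leRHS]mulr1 ler_pdivlMl// mulrA /weight expRN.
rewrite ler_pdivrMr ?expR_gt0// mul1r (le_trans _ (expR_ge1Dx _))//.
by rewrite lerDr.
Qed.

(** Uniform in [s], unlike the bound behind [duhamel_le]; with [nabs_weight] it gives a
    summable majorant in [k] at each fixed [t > 0]. *)
Lemma integrand_le m p c d k s t : trajectory m c -> trajectory p d -> 0 <= s <= t ->
  normc (propagator (t - s) k * quad (c^~ s) (d^~ s) k) <=
  C * conv m p k * (nabs k * weight t k).
Proof.
move=> tc td /andP[s0 st]; have [lm _ _ cm] := tc; have [lp _ _ dp] := td.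
have ts0 : 0 <= t - s by rewrite subr_ge0.
rewrite Normc.normcM normc_propagator.
apply: (@le_trans _ _ (weight (t - s) k * (C * nabs k * conv m p k * weight s k))).
  rewrite ler_pM ?expR_ge0 ?normc_ge0 ?propagator_weight//.
  by apply: quad_weight => // j; [exact: cm|exact: dp].
have -> : weight t k = weight (t - s) k * weight s k.
  by rewrite /weight -expRD; congr expR; ring.
by rewrite le_eqVlt; apply/orP; left; apply/eqP; ring.
Qed.

End MildProblem.

(** * Absolutely convergent Fourier series *)

Section Fourier.
Context {R : realType}.
Implicit Types (x y : R) (k j : int) (b c : int -> R[i]) (f g : R -> R).

Definition mode k x : R[i] := expi (k%:~R * x).

Definition hermitian c : Prop := forall k, c (- k) = conjc (c k).

Lemma fourier_seriesE c x :
  fourier_series c x = zsum (fun k => complex.Re (c k * mode k x)).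
Proof. by []. Qed.

Lemma modeD k j x : mode (k + j) x = mode k x * mode j x.
Proof. by rewrite /mode rmorphD mulrDl expiD. Qed.

Lemma normc_mode k x : normc (mode k x) = 1.
Proof. exact: normc_expi. Qed.

Lemma modeN k x : mode (- k) x = conjc (mode k x).
Proof. by rewrite /mode conj_expi rmorphN mulNr. Qed.

Lemma mode_period k x : mode k (x + 2 * pi) = mode k x.
Proof.
rewrite /mode mulrDr expiD.
suff -> : expi (k%:~R * (2 * pi)) = 1 :> R[i] by rewrite mulr1.
have e1 : expi (2 * pi) = 1 :> R[i].
  by rewrite /expi mulr_natl cos2pi sin2pi.
have en n : expi (n%:R * (2 * pi)) = 1 :> R[i].
  elim: n => [|n IH]; first by rewrite mul0r expi0.
  by rewrite -natr1 mulrDl mul1r expiD IH e1 mulr1.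
case: k => n; first exact: en.
rewrite NegzE mulrNz mulNr -conj_expi en.
by apply: complex_ext; rewrite /= ?oppr0.
Qed.

Lemma ccont_mode k : ccont (mode k).
Proof.
apply: (@ccont_comp _ expi (fun x => k%:~R * x)); first exact: ccont_expi.
exact: continuous_mull.
Qed.

Lemma Re_mode_le (z : R[i]) k x : `|complex.Re (z * mode k x)| <= normc z.
Proof. by rewrite (le_trans (normc_Re _))// Normc.normcM normc_mode mulr1. Qed.

Lemma cl1_mode c x : cl1 c -> cl1 (fun k => c k * mode k x).
Proof.
by move=> lc; apply: cl1_le lc _ => k; rewrite Normc.normcM normc_mode mulr1.
Qed.

Arguments cl1_mode {c} x.

Lemma ccont_cmode (z : R[i]) k : ccont (fun x => z * mode k x).
Proof. by apply: ccontM; [exact: ccont_cst|exact: ccont_mode]. Qed.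

Lemma fourier_series_continuous c : cl1 c -> continuous (fourier_series c).
Proof.
move=> lc.
apply: (@zsum_continuous _ _ (fun x k => complex.Re (c k * mode k x)) _ lc).
  by move=> x k; exact: Re_mode_le.
move=> k.
exact: (ccont_cmode (c k) k).1.
Qed.

Lemma fourier_series_period c : periodic (fourier_series c) (2 * pi).
Proof. by move=> x; rewrite !fourier_seriesE; under eq_zsum do rewrite mode_period. Qed.

(** [fourier_series] keeps only real parts; for Hermitian coefficients nothing is
    lost, and the complex sum can be manipulated instead. *)
Lemma hermitian_series c x : cl1 c -> hermitian c ->
  czsum (fun k => c k * mode k x) = (fourier_series c x)%:C%C.
Proof.
move=> lc hc; have lm := cl1_mode x lc.
have : conjc (czsum (fun k => c k * mode k x)) = czsum (fun k => c k * mode k x).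
  rewrite -czsum_conj_refl//; congr czsum; apply/funext => k.
  by rewrite cconjM hc modeN !cconjK.
move=> /(congr1 (@complex.Im _)); rewrite cIm_conj => im.
have im0 : complex.Im (czsum (fun k => c k * mode k x)) = 0 by lra.
by apply: complex_ext; [done|rewrite im0].
Qed.

(** The antiderivatives [sin (k x) / k] and [- cos (k x) / k] are periodic, so their
    increments over a period vanish. *)
Lemma cint_mode k : k != 0 ->
  cint (- pi) pi (mode k) = 0.
Proof.
move=> k0; have kR : (k%:~R : R) != 0 by rewrite intr_eq0.
have pp : - pi <= pi :> R by rewrite -subr_ge0 opprK addr_ge0// pi_ge0.
have := mode_period k (- pi); rewrite (_ : - pi + 2 * pi = pi :> R); last by ring.
move=> [cE sE].
have [c1 c2] := ccont_mode k.
have d1 x : is_derive x 1 (fun x => sin (k%:~R * x) / k%:~R) (cos (k%:~R * x)).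
  by apply: is_derive_eq; rewrite /GRing.scale /=; field.
have d2 x : is_derive x 1 (fun x => - cos (k%:~R * x) / k%:~R) (sin (k%:~R * x)).
  by apply: is_derive_eq; rewrite /GRing.scale /=; field.
apply: complex_ext => /=.
  by rewrite (rint_FTC pp c1 d1) sE subrr.
by rewrite (rint_FTC pp c2 d2) cE subrr.
Qed.

Lemma twopi_gt0 : 0 < 2 * pi :> R.
Proof. by rewrite mulr_gt0// pi_gt0. Qed.

Lemma Npi_le_pi : - pi <= pi :> R.
Proof. by have := twopi_gt0; lra. Qed.

Definition cmean (h : R -> R[i]) : R[i] := ((2 * pi)^-1)%:C%C * cint (- pi) pi h.

Lemma fourier_coefE f k :
  fourier_coef f k = cmean (fun x => (f x)%:C%C * mode (- k) x).
Proof.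
rewrite /fourier_coef /cmean /mean; apply: complex_ext; rewrite ?cReM ?cImM /=.
  rewrite mul0r subr0; congr (_ * _); apply: eq_rint => x _.
  by rewrite /mode rmorphN mulNr.
rewrite mul0r addr0; congr (_ * _); apply: eq_rint => x _.
by rewrite /mode rmorphN mulNr.
Qed.

Lemma cmean_mode k : cmean (mode k) = (k == 0)%:R.
Proof.
rewrite /cmean; have [->|k0] := eqVneq k 0; last by rewrite cint_mode// mulr0.
have -> : cint (- pi) pi (mode 0) = ((2 * pi)%:C)%C :> R[i].
  apply: complex_ext => /=.
    rewrite (@eq_rint _ _ _ _ (fun=> 1)) ?rint_cst ?Npi_le_pi//; first by ring.
    by move=> x _; rewrite mul0r cos0.
  rewrite (@eq_rint _ _ _ _ (fun=> 0)) ?rint_cst ?Npi_le_pi//; first by rewrite mul0r.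
  by move=> x _; rewrite mul0r sin0.
by rewrite -rmorphM /= mulVf ?gt_eqF// twopi_gt0.
Qed.

Lemma ccont_coef_integrand f k : continuous f ->
  ccont (fun x => (f x)%:C%C * mode k x).
Proof. by move=> cf; apply: ccontM; [exact: ccont_real|exact: ccont_mode]. Qed.

Lemma meanE f : mean f = complex.Re (fourier_coef f 0).
Proof.
rewrite /fourier_coef /mean /=; congr (_ * _); apply: eq_rint => x _.
by rewrite mul0r oppr0 cos0 sin0 mulr1 mul0r subr0.
Qed.

Lemma fourier_coef0 f : fourier_coef f 0 = (mean f)%:C%C.
Proof.
apply: complex_ext; first by rewrite -meanE.
rewrite /= /mean (_ : Rintegral _ _ _ = rint (-pi) pi (fun=> 0)).
  by rewrite rint_cst ?Npi_le_pi// mul0r mulr0.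
by apply: eq_rint => x _; rewrite mul0r oppr0 sin0 mulr0 mul0r addr0.
Qed.

Lemma fourier_coefD f g k : continuous f -> continuous g ->
  fourier_coef (fun x => f x + g x) k = fourier_coef f k + fourier_coef g k.
Proof.
move=> cf cg; rewrite !fourier_coefE /cmean -mulrDr -cintD; try exact: ccont_coef_integrand.
by congr (_ * _); apply: eq_cint => x _; rewrite rmorphD mulrDl.
Qed.

Lemma fourier_coefZ (r : R) f k : continuous f ->
  fourier_coef (fun x => r * f x) k = r%:C%C * fourier_coef f k.
Proof.
move=> cf; rewrite !fourier_coefE /cmean mulrCA -[X in _ = _ * X]cintZ;
  last exact: ccont_coef_integrand.
by congr (_ * _); apply: eq_cint => x _; rewrite rmorphM /= mulrA.
Qed.

Lemma continuousZ (r : R) f : continuous f -> continuous (fun x => r * f x).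
Proof. by move=> cf x; apply: cvgM; [exact: cvg_cst|exact: cf]. Qed.

Lemma fourier_coefB f g k : continuous f -> continuous g ->
  fourier_coef (fun x => f x - g x) k = fourier_coef f k - fourier_coef g k.
Proof.
move=> cf cg; have := fourier_coefD k cf (@continuousZ (-1) _ cg).
rewrite fourier_coefZ//; under [X in fourier_coef X]funext do rewrite mulN1r.
by move=> ->; rewrite rmorphN mulNr mul1r.
Qed.

Lemma fourier_coef_cst (r : R) k : fourier_coef (fun=> r) k = ((k == 0)%:R * r)%:C%C.
Proof.
rewrite fourier_coefE /cmean cintZ; last exact: ccont_mode.
rewrite mulrCA -/(cmean (mode (- k))) cmean_mode oppr_eq0 mulrC rmorphM /=.
by case: (k == 0).
Qed.

Lemma fourier_coef_hermitian f : continuous f -> hermitian (fourier_coef f).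
Proof.
move=> cf k; rewrite !fourier_coefE opprK /cmean cconjM.
rewrite -cint_conj; last exact: ccont_coef_integrand.
rewrite cconj_real; congr (_ * _); apply: eq_cint => x _.
by rewrite cconjM -modeN opprK cconj_real.
Qed.

Lemma fourier_seriesD (b c : int -> R[i]) x : cl1 b -> cl1 c ->
  fourier_series (fun k => b k + c k) x = fourier_series b x + fourier_series c x.
Proof.
move=> lb lc; rewrite !fourier_seriesE -zsumD.
- by apply: eq_zsum => k; rewrite mulrDl cReD.
- exact: (cl1_Re (cl1_mode x lb)).
- exact: (cl1_Re (cl1_mode x lc)).
Qed.

Lemma zsum_single k (r : R) : zsum (fun j => if j == k then r else 0) = r.
Proof.
have pE n : psum (fun j => if j == k then r else 0) n = if (`|k| <= n)%N then r else 0.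
  elim: n => [|n IH]; first by rewrite psum0 leqn0 absz_eq0 [k == 0]eq_sym.
  rewrite psumS IH; case: ifPn => k1; case: ifPn => k2; case: ifPn => k3;
    case: ifPn => k4; rewrite ?addr0 ?add0r//; exfalso; lia.
have cr : (fun=> r) n @[n --> \oo] --> r by exact: cvg_cst.
apply: cvg_lim => //; apply: cvg_trans cr.
apply: near_eq_cvg; exists `|k|%N => // n /= kn.
by rewrite pE kn.
Qed.

Lemma period_bounded g : continuous g ->
  exists G : R, forall x, - pi <= x <= pi -> `|g x| <= G.
Proof.
move=> cg.
have [|x0 _ gx0] := @EVT_max _ (fun x => `|g x|) (- pi) pi Npi_le_pi.
  by apply: continuous_subspaceT => x; apply: cvg_norm; exact: cg.
by exists `|g x0| => x xpi; apply: gx0; rewrite in_itv.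
Qed.

(** Integrate the series of the first factor term by term: multiplying by a mode
    shifts the coefficients of [g]. *)
Lemma fourier_coefM c g k : cl1 c -> hermitian c -> continuous g ->
  fourier_coef (fun x => fourier_series c x * g x) k =
  czsum (fun j => c j * fourier_coef g (k - j)).
Proof.
move=> lc hc cg; have [G gG] := period_bounded cg.
pose h x j := (c j * mode j x) * ((g x)%:C%C * mode (- k) x).
have hE x : czsum (h x) = (fourier_series c x * g x)%:C%C * mode (- k) x.
  rewrite rmorphM /= -hermitian_series// -mulrA mulrC -czsumZ; last exact: cl1_mode.
  by congr czsum; apply/funext => j; rewrite mulrC.
have ch j : ccont (h^~ j).
  by apply: ccontM; [exact: ccont_cmode|exact: ccont_coef_integrand].
have hG x j : - pi <= x <= pi -> normc (h x j) <= G * normc (c j).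
  move=> xpi; rewrite /h !Normc.normcM !normc_mode !mulr1 normc_real mulrC.
  by rewrite ler_wpM2r ?normc_ge0// gG.
have lh : cl1 (fun j => cint (- pi) pi (h^~ j)).
  apply: (cl1_le (@l1Z _ (2 * pi * G) _ lc)) => j.
  have -> : 2 * pi * G * normc (c j) = rint (- pi) pi (fun=> G * normc (c j)).
    by rewrite rint_cst ?Npi_le_pi//; ring.
  by apply: normc_cint => // [x|x]; [exact: cvg_cst|exact: hG].
rewrite fourier_coefE /cmean -(funext hE).
rewrite (@cint_czsum _ _ _ _ (fun j => G * normc (c j))) ?Npi_le_pi//.
- rewrite -czsumZ//; congr czsum; apply/funext => j.
  rewrite fourier_coefE /cmean mulrCA -[X in _ = _ * X]cintZ.
    congr (_ * _); apply: eq_cint => x _.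
    by rewrite /h opprB addrC modeD; ring.
  exact: ccont_coef_integrand.
- exact: l1Z.
- rewrite (funext hE); apply: ccont_coef_integrand => x.
  by apply: cvgM; [exact: fourier_series_continuous|exact: cg].
Qed.

(** Convolution with the coefficients of the constant function 1. *)
Lemma fourier_coef_series c k : cl1 c -> hermitian c ->
  fourier_coef (fourier_series c) k = c k.
Proof.
move=> lc hc; have := @fourier_coefM c (fun=> 1) k lc hc.
under [X in fourier_coef X]funext do rewrite mulr1.
move=> ->; last by move=> x; exact: cvg_cst.
apply: complex_ext; rewrite -[RHS](zsum_single k); apply: eq_zsum => j;
  rewrite fourier_coef_cst subr_eq0 [k == j]eq_sym mulr1 ?cReM ?cImM /=;
  by case: eqVneq => [->|_]; rewrite ?mulr1 ?mulr0 ?subr0 ?addr0 ?add0r.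
Qed.

Lemma fourier_coefM_series b c k : cl1 b -> hermitian b -> cl1 c -> hermitian c ->
  fourier_coef (fun x => fourier_series b x * fourier_series c x) k =
  czsum (fun j => b j * c (k - j)).
Proof.
move=> lb hb lc hc; rewrite fourier_coefM//; last exact: fourier_series_continuous.
by congr czsum; apply/funext => j; rewrite fourier_coef_series.
Qed.

Lemma cl1_convolution b c k : cl1 b -> cl1 c -> cl1 (fun j => b j * c (k - j)).
Proof.
by move=> lb lc; apply: (cl1_le (l1_conv_term k lb lc)) => j; rewrite Normc.normcM.
Qed.

End Fourier.
Arguments cl1_mode {R c} x.
Arguments cl1_convolution {R b c} k.

(** * Differentiation, Hilbert transform and velocity on coefficients *)

Section Termwise.
Context {R : realType}.
Implicit Types (x y : R) (k j : int) (c : int -> R[i]) (f g : R -> R).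

Definition deriv_coef c k : R[i] := (0 +i* k%:~R)%C * c k.

Lemma is_derive_mode_term (z : R[i]) k x :
  is_derive x 1 (fun x => complex.Re (z * mode k x))
    (complex.Re ((0 +i* k%:~R)%C * z * mode k x)).
Proof.
rewrite (_ : (fun _ => _) = fun x => complex.Re z * cos (k%:~R * x) -
    complex.Im z * sin (k%:~R * x)); last first.
  by apply/funext => y; rewrite cReM.
apply: is_derive_eq; rewrite !(cReM, cImM) /GRing.scale /=; ring.
Qed.

Lemma derive_lipschitz f (df : R -> R) (M : R) x y :
  (forall x, is_derive x 1 f (df x)) -> (forall x, `|df x| <= M) ->
  `|f y - f x| <= M * `|y - x|.
Proof.
move=> fdf dfM.
have cf : continuous f.
  move=> z; apply: differentiable_continuous; apply/derivable1_diffP.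
  by have [] := fdf z.
wlog xy : x y / x <= y.
  move=> H; have [|/ltW] := leP x y; first exact: H.
  by move=> /H; rewrite distrC [`|x - y|]distrC.
have [z _ ->] : exists2 z, z \in `[x, y] & f y - f x = df z * (y - x).
  by apply: MVT_segment => //; exact: continuous_subspaceT.
by rewrite normrM ler_wpM2r.
Qed.

(** By the mean value theorem the difference quotients of the [k]-th term are bounded by
    [|k| |c_k|], uniformly in the increment, so Tannery's theorem applies. *)
Lemma fourier_series_derive c x : cl1 c -> cl1 (deriv_coef c) ->
  is_derive x 1 (fourier_series c) (fourier_series (deriv_coef c) x).
Proof.
move=> lc ld; pose g k y := complex.Re (c k * mode k y).
have lg y : l1 (g^~ y) by exact: (cl1_Re (cl1_mode y lc)).
have dg k y : is_derive y 1 (g k) (complex.Re (deriv_coef c k * mode k y)).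
  exact: is_derive_mode_term.
have H : h^-1 *: ((fourier_series c \o shift x) (h *: 1) - fourier_series c x)
    @[h --> 0^'] --> fourier_series (deriv_coef c) x.
  rewrite (_ : (fun h => _) =
      fun h => zsum (fun k => h^-1 * (g k (h *: 1 + x) - g k x))); last first.
    by apply/funext => h; rewrite zsumZ ?zsumB//; exact: l1B.
  apply: (@zsum_cvg _ _ _ _ (fun h k => h^-1 * (g k (h *: 1 + x) - g k x))
    (fun k => complex.Re (deriv_coef c k * mode k x)) _ ld).
  - by move=> k; exact: Re_mode_le.
  - apply: nearW => h k; have [->|h0] := eqVneq h 0.
      by rewrite invr0 mul0r normr0 normc_ge0.
    rewrite normrM normfV mulrC ler_pdivrMr ?normr_gt0//.
    have := derive_lipschitz x (h *: 1 + x) (dg k) (fun y => Re_mode_le _ k y).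
    by rewrite addrK /GRing.scale /= mulr1.
  - move=> k; have [dgk <-] := dg k x; exact: dgk.
apply: DeriveDef; first by apply/cvg_ex; eexists; exact: H.
exact: cvg_lim H.
Qed.

Definition hilbert_coef c k : R[i] := (0 -i* (sgz k)%:~R)%C * c k.

Definition velocity_coef c k : R[i] := (- (nabs k)^-1)%:C%C * c k.

Lemma intr_sg_nabs k : k%:~R = (sgz k)%:~R * nabs k :> R.
Proof. by rewrite -[nabs k]/((`|k|%N%:Z)%:~R) -intrM {1}[k]intEsg mulrC. Qed.

Lemma nabs_eq0 k : (nabs k == 0 :> R) = (k == 0).
Proof. by rewrite pnatr_eq0 absz_eq0. Qed.

Lemma deriv_velocity c : deriv_coef (velocity_coef c) = hilbert_coef c.
Proof.
apply/funext => k; rewrite /deriv_coef /velocity_coef /hilbert_coef mulrA; congr (_ * _).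
have [->|k0] := eqVneq k 0.
  by apply: complex_ext; rewrite /= ?sgz0 ?mul0r ?subr0 ?addr0 ?oppr0.
apply: complex_ext; rewrite ?cReM ?cImM /= ?mul0r ?mulr0 ?subr0 ?add0r//.
by rewrite intr_sg_nabs mulrN mulfK// nabs_eq0.
Qed.

Lemma normc_hilbert c k : normc (hilbert_coef c k) <= normc (c k).
Proof.
rewrite Normc.normcM ler_piMl ?normc_ge0// (le_trans (normc_le_ReIm _))//=.
by rewrite normr0 add0r normrN; case: (sgzP k); rewrite ?normr0 ?normr1 ?normrN1.
Qed.

Lemma normc_velocity c k : normc (velocity_coef c k) <= normc (c k).
Proof.
rewrite Normc.normcM ler_piMl ?normc_ge0// normc_real normrN normfV ger0_norm ?nabs_ge0//.
have [->|k0] := eqVneq k 0; first by rewrite /nabs invr0.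
by rewrite invf_le1 ?ltr0n ?absz_gt0// ler1n absz_gt0.
Qed.

Lemma cl1_hilbert c : cl1 c -> cl1 (hilbert_coef c).
Proof. by move=> lc; apply: cl1_le lc _; exact: normc_hilbert. Qed.

Lemma cl1_velocity c : cl1 c -> cl1 (velocity_coef c).
Proof. by move=> lc; apply: cl1_le lc _; exact: normc_velocity. Qed.

Lemma hermitian_hilbert c : hermitian c -> hermitian (hilbert_coef c).
Proof.
move=> hc k; rewrite /hilbert_coef hc cconjM; congr (_ * _).
by apply: complex_ext; rewrite /= ?sgzN ?rmorphN.
Qed.

Lemma hermitian_velocity c : hermitian c -> hermitian (velocity_coef c).
Proof. by move=> hc k; rewrite /velocity_coef hc cconjM cconj_real /nabs abszN. Qed.

Lemma hermitian_deriv c : hermitian c -> hermitian (deriv_coef c).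
Proof.
move=> hc k; rewrite /deriv_coef hc cconjM; congr (_ * _).
by apply: complex_ext; rewrite /= ?rmorphN.
Qed.

Lemma multiplier_series (s : int -> R[i]) c : cl1 c -> hermitian c ->
  multiplier s (fourier_series c) = fourier_series (fun k => s k * c k).
Proof.
move=> lc hc; congr fourier_series; apply/funext => k.
by rewrite fourier_coef_series.
Qed.

Lemma hilbert_series c : cl1 c -> hermitian c ->
  hilbert (fourier_series c) = fourier_series (hilbert_coef c).
Proof. exact: multiplier_series. Qed.

Lemma velocity_series c : cl1 c -> hermitian c ->
  velocity (fourier_series c) (fourier_series (velocity_coef c)).
Proof.
move=> lc hc; have lv := cl1_velocity lc; split.
- exact: fourier_series_period.
- rewrite meanE fourier_coef_series//; last exact: hermitian_velocity.
  by rewrite /velocity_coef /nabs invr0 cReM /= oppr0 !mul0r subr0.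
- move=> x; rewrite (hilbert_series lc hc) -deriv_velocity.
  apply: fourier_series_derive => //.
  by rewrite deriv_velocity; exact: cl1_hilbert.
Qed.

(** Two velocities differ by a constant, which the zero mean forces to vanish. *)
Lemma velocity_unique (w u v : R -> R) : velocity w u -> velocity w v -> u = v.
Proof.
move=> [_ mu du] [_ mv dv].
have cont (h : R -> R) : (forall x, is_derive x 1 h (hilbert w x)) -> continuous h.
  move=> dh z; apply: differentiable_continuous; apply/derivable1_diffP.
  by have [] := dh z.
have cu := cont u du; have cv := cont v dv.
have d0 x : is_derive x 1 (u - v) 0.
  by apply: is_derive_eq; exact: subrr.
have uv x : u x = v x + (u 0 - v 0).
  have h : u x - v x = u 0 - v 0 by exact: (@is_derive_0_is_cst _ (u - v) x 0 d0).
  by rewrite -h addrC subrK.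
have e0 : u 0 - v 0 = 0.
  move: (u 0 - v 0) uv => r uv.
  have : mean u = mean v + r.
    rewrite (funext uv) !meanE fourier_coefD//; last by move=> x; exact: cvg_cst.
    by rewrite fourier_coef_cst eqxx mul1r cReD.
  by rewrite mu mv add0r.
by apply/funext => x; rewrite uv e0 addr0.
Qed.

Lemma wiener_coefs f : wiener f ->
  [/\ cl1 (fourier_coef f), hermitian (fourier_coef f) &
      f = fourier_series (fourier_coef f)].
Proof.
move=> [_ fin fE]; have lc : cl1 (fourier_coef f).
  by apply: l1_esum fin => k; exact: normc_ge0.
have {}fE : f = fourier_series (fourier_coef f) by exact/funext.
split => //; apply: fourier_coef_hermitian; rewrite fE.
exact: fourier_series_continuous.
Qed.

Lemma wiener_norm_cl1 f : cl1 (fourier_coef f) ->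
  wiener_norm f = (zsum (fun k => normc (fourier_coef f k)))%:E.
Proof. by move=> lf; apply: esum_zsum => // k; exact: normc_ge0. Qed.

Lemma wiener_series c : cl1 c -> hermitian c -> wiener (fourier_series c).
Proof.
move=> lc hc.
have cE : fourier_coef (fourier_series c) = c.
  by apply/funext => k; exact: fourier_coef_series.
split; [exact: fourier_series_period| |by move=> x; rewrite cE].
by rewrite wiener_norm_cl1 cE// ltry.
Qed.

End Termwise.

(** * Coefficients of the nonlinearity *)

Section Equation.
Context {R : realType}.
Implicit Types (x y t : R) (k j : int) (f g : R -> R).

Variables (a w_av sigma : R).

Definition symbol_rate k : R := abs_pow sigma k.
Definition symbol_phase k : R := w_av * (sgz k)%:~R.

(** In [k c_j d_(k - j) / |k - j|] the derivative of the product [u w] acts as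
    multiplication by [k = j + (k - j)].  At [j = k] the division by 0 gives 0, in
    accordance with the zero mean of the velocity. *)
Definition kernel k j : R[i] :=
  if k == 0 then 0 else
  (0 +i* (a * (k%:~R * (nabs (k - j))^-1) - (1 + a) * (sgz (k - j))%:~R))%C.

Definition kernel_size : R := `|1 + a| + `|a|.

Lemma kernel_size_gt0 : 0 < kernel_size.
Proof.
rewrite /kernel_size lt_def addr_ge0// andbT.
rewrite paddr_eq0// !normr_eq0; apply/negP => /andP[/eqP h /eqP a0].
by move: h; rewrite a0 addr0 => /eqP; rewrite oner_eq0.
Qed.

Lemma normr_intr k : `|k%:~R : R| = nabs k.
Proof. by rewrite -intr_norm. Qed.

Lemma normr_sgz k : `|(sgz k)%:~R : R| <= 1.
Proof. by case: (sgzP k); rewrite ?normr0 ?normr1 ?normrN1. Qed.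

Lemma nabs_inv_le1 k : (nabs k)^-1 <= 1 :> R.
Proof.
have [->|k0] := eqVneq k 0; first by rewrite /nabs invr0.
by rewrite invf_le1 ?ltr0n ?absz_gt0// ler1n absz_gt0.
Qed.

Lemma kernel_le k j : normc (kernel k j) <= kernel_size * nabs k.
Proof.
rewrite /kernel; have [->|k0] := eqVneq k 0; first by rewrite Normc.normc0 mulr0.
have k1 : 1 <= nabs k :> R by rewrite ler1n absz_gt0.
apply: le_trans (normc_le_ReIm _) _; rewrite /= normr0 add0r.
apply: le_trans (ler_normB _ _) _; rewrite /kernel_size [leRHS]mulrDl [leLHS]addrC.
rewrite !normrM; apply: lerD.
  by rewrite ler_wpM2l// (le_trans (normr_sgz _)).
rewrite ler_wpM2l// normr_intr ler_piMr ?nabs_ge0// ger0_norm ?invr_ge0 ?nabs_ge0//.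
exact: nabs_inv_le1.
Qed.

Lemma kernelN k j : kernel (- k) (- j) = conjc (kernel k j).
Proof.
rewrite /kernel oppr_eq0; case: ifP => _; first by apply: complex_ext; rewrite /= ?oppr0.
by apply: complex_ext; rewrite //= -opprD sgzN /nabs abszN !rmorphN /=; ring.
Qed.

Lemma symbol_rate_ge k : 1 <= sigma -> nabs k <= symbol_rate k.
Proof.
move=> s1; rewrite /symbol_rate /abs_pow -/(nabs k).
have [->|k0] := eqVneq k 0; first by rewrite powR_ge0.
have k1 : 1 <= nabs k :> R by rewrite ler1n absz_gt0.
by rewrite -[leLHS]powRr1 ?nabs_ge0// ler_powR.
Qed.

Lemma symbol_rateN k : symbol_rate (- k) = symbol_rate k.
Proof. by rewrite /symbol_rate /abs_pow abszN. Qed.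

Lemma symbol_phaseN k : symbol_phase (- k) = - symbol_phase k.
Proof. by rewrite /symbol_phase sgzN rmorphN mulrN. Qed.

Lemma semigroupE t f :
  semigroup w_av sigma t f = fourier_series
    (fun k => propagator symbol_rate symbol_phase t k * fourier_coef f k).
Proof.
by congr fourier_series; apply/funext => k; rewrite /propagator /symbol_phase mulrA.
Qed.

Lemma fourier_coef_proj0 f k : continuous f ->
  fourier_coef (proj0 f) k = if k == 0 then 0 else fourier_coef f k.
Proof.
move=> cf; rewrite /proj0 fourier_coefB//; last by move=> x; exact: cvg_cst.
rewrite fourier_coef_cst; case: eqVneq => [->|_].
  by rewrite mul1r fourier_coef0 subrr.
by rewrite mul0r subr0.
Qed.

Section Nonlinearity.
Variable c : int -> R[i].
Hypotheses (lc : cl1 c) (hc : hermitian c) (ld : cl1 (deriv_coef c)).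

Let w := fourier_series c.
Let u := fourier_series (velocity_coef c).
Let h := fourier_series (hilbert_coef c).
Let dw := fourier_series (deriv_coef c).

Lemma nonlinearityE :
  nonlinearity a w u =
  fun x => (1 + a) * (w x * h x) - a * (w x * h x + dw x * u x).
Proof.
apply/funext => x; rewrite /nonlinearity hilbert_series//.
congr (_ - _ * _); rewrite derive1E.
have dW : is_derive x 1 w (dw x) by exact: fourier_series_derive.
have dU : is_derive x 1 u (h x).
  rewrite /h -deriv_velocity; apply: fourier_series_derive.
    exact: cl1_velocity.
  by rewrite deriv_velocity; exact: cl1_hilbert.
have dP : is_derive x 1 (fun y => u y * w y) (w x * h x + dw x * u x).
  by apply: is_derive_eq; rewrite /GRing.scale /= addrC; congr (_ + _); rewrite mulrC.
by case: dP.
Qed.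

(** Leibniz' rule in Fourier variables: [k = (k - j) + j] distributes the derivative
    over the velocity, whose derivative is the Hilbert transform, and over [w]. *)
Lemma kernel_split k j : k != 0 ->
  kernel k j * (c j * c (k - j)) =
  (1 + a)%:C%C * (c j * hilbert_coef c (k - j)) +
  (- a)%:C%C * (c j * hilbert_coef c (k - j) +
                deriv_coef c j * velocity_coef c (k - j)).
Proof.
move=> k0; rewrite /kernel (negPf k0) /hilbert_coef /deriv_coef /velocity_coef.
have kE : k%:~R * (nabs (k - j))^-1 =
    j%:~R * (nabs (k - j))^-1 + (sgz (k - j))%:~R :> R.
  have [kj|kj] := eqVneq (k - j) 0; first by rewrite kj sgz0 /nabs invr0 !mulr0 addr0.
  rewrite -[in k%:~R](subrK j k) addrC rmorphD mulrDl /=; congr (_ + _).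
  by rewrite intr_sg_nabs mulfK// nabs_eq0.
rewrite kE; move: (j%:~R) (nabs _)^-1 (sgz _)%:~R => r1 r2 r3.
by apply: complex_ext; rewrite !(cReM, cImM, cReD, cImD) /=; ring.
Qed.

(** Products are only expanded on coefficients, after [(u w)' = u' w + u w'] has been
    applied pointwise; the projection makes the mode [k = 0] agree with the kernel. *)
Lemma nonlinearity_coef k :
  fourier_coef (proj0 (nonlinearity a w u)) k = quad kernel c c k.
Proof.
have lh := cl1_hilbert lc; have lv := cl1_velocity lc.
have hh := hermitian_hilbert hc; have hv := hermitian_velocity hc.
have hd := hermitian_deriv hc.
have cw : continuous w by exact: fourier_series_continuous.
have ch : continuous h by exact: fourier_series_continuous.
have cu : continuous u by exact: fourier_series_continuous.
have cd : continuous dw by exact: fourier_series_continuous.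
have cwh : continuous (fun x => w x * h x).
  by move=> x; apply: cvgM; [exact: cw|exact: ch].
have cdu : continuous (fun x => dw x * u x).
  by move=> x; apply: cvgM; [exact: cd|exact: cu].
have cs : continuous (fun x => w x * h x + dw x * u x).
  by move=> x; apply: cvgD; [exact: cwh|exact: cdu].
rewrite nonlinearityE fourier_coef_proj0; last first.
  by move=> x; apply: cvgB;
    [exact: (@continuousZ _ _ _ cwh)|exact: (@continuousZ _ _ _ cs)].
case: eqVneq => [->|k0].
  rewrite /quad (_ : (fun j => _) = fun=> 0).
    by apply: complex_ext; rewrite /= zsum0.
  by apply/funext => j; rewrite /kernel eqxx mul0r.
rewrite fourier_coefB ?fourier_coefZ ?fourier_coefD//; try exact: continuousZ.
rewrite !fourier_coefM_series// /quad (funext (fun j => kernel_split j k0)).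
have l1h := cl1_convolution k lc lh; have l1u := cl1_convolution k ld lv.
rewrite czsumD; [|exact: cl1Z|by apply: cl1Z; exact: cl1D].
rewrite !czsumZ//; last exact: cl1D.
by rewrite czsumD// rmorphN mulNr.
Qed.

End Nonlinearity.
End Equation.

(** * The Duhamel formula on coefficients *)

Section Duhamel.
Context {R : realType}.
Implicit Types (x y t s : R) (k j : int) (f g : R -> R).

Variables (a w_av sigma varpi : R) (w0 : R -> R).
Hypotheses (sigma_ge1 : 1 <= sigma) (varpi01 : 0 < varpi < 1).

Let rho := @symbol_rate R sigma.
Let theta := @symbol_phase R w_av.
Let q := @kernel R a.
Let c0 := fourier_coef w0.

Let rho_ge k : nabs k <= rho k.
Proof. exact: symbol_rate_ge. Qed.
Let q_le k j : normc (q k j) <= kernel_size a * nabs k.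
Proof. exact: kernel_le. Qed.
Let C_gt0 : 0 < kernel_size a := kernel_size_gt0 a.

Hypothesis lc0 : cl1 c0.

Section Trajectory.
Variables (m : int -> R) (c : int -> R -> R[i]).
Hypotheses (tc : trajectory varpi m c) (hc : forall t, hermitian (c^~ t)).

Lemma cl1_deriv_traj t : 0 < t -> cl1 (deriv_coef (c^~ t)).
Proof.
move=> t0; have [lm _ _ cm] := tc.
apply: (cl1_le (@l1Z _ (varpi * t)^-1 _ lm)) => k.
have m0 := traj_ge0 k tc.
rewrite /deriv_coef Normc.normcM [leRHS]mulrC.
have -> : normc (0 +i* k%:~R)%C = nabs k :> R.
  by rewrite /= expr0n add0r sqrtr_sqr normr_intr.
apply: (@le_trans _ _ (nabs k * (m k * weight varpi t k))).
  by rewrite ler_wpM2l ?nabs_ge0// cm// ltW.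
by rewrite mulrCA ler_wpM2l// nabs_weight.
Qed.

Lemma integrand_series t s (u : R -> R) : 0 < s ->
  velocity (fourier_series (c^~ s)) u ->
  semigroup w_av sigma (t - s) (proj0 (nonlinearity a (fourier_series (c^~ s)) u)) =
  fourier_series (fun k => propagator rho theta (t - s) k * quad q (c^~ s) (c^~ s) k).
Proof.
move=> s0 vu; have lcs := @traj_cl1 _ _ varpi01 _ _ s tc.
rewrite (velocity_unique vu (velocity_series lcs (hc s))) semigroupE.
congr fourier_series; apply/funext => k.
by rewrite nonlinearity_coef//; exact: cl1_deriv_traj.
Qed.

(** By [nabs_weight] the integrand is dominated, at a fixed [t > 0] and uniformly in [s],
    by a summable sequence, so sum and time integral can be exchanged. *)
Lemma duhamel_term_series t x (u : R -> R -> R) : 0 <= t ->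
  (forall s, 0 <= s -> velocity (fourier_series (c^~ s)) (u s)) ->
  rint 0 t (fun s => semigroup w_av sigma (t - s)
    (proj0 (nonlinearity a (fourier_series (c^~ s)) (u s))) x) =
  fourier_series (fun k => duhamel_integral rho theta q c c k t) x.
Proof.
move=> + vu; rewrite le_eqVlt => /predU1P[<-|t0].
  rewrite rint_set1 fourier_seriesE -[LHS](@zsum0 R); apply: eq_zsum => k.
  by rewrite /duhamel_integral maxxx /cint !rint_set1 mulr0 mul0r.
have tt := ltW t0.
(* clipping to [0, t] makes the bounds and the continuity global *)
pose clip s := Num.max 0 (Num.min t s).
have clip_le s : 0 <= clip s <= t.
  by rewrite /clip le_max lexx /= ge_max tt ge_min lexx.
have clipE s : 0 <= s <= t -> clip s = s.
  by move=> /andP[s0 st]; rewrite /clip min_r// max_r.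
have ccl : continuous clip.
  move=> s; apply: continuous_max; first exact: cvg_cst.
  by apply: continuous_min; [exact: cvg_cst|exact: cvg_id].
pose z s k := propagator rho theta (t - clip s) k * quad q (c^~ (clip s)) (c^~ (clip s)) k.
have cz k : ccont (z^~ k).
  apply: ccontM.
    apply: (@ccont_comp _ (propagator rho theta ^~ k) (fun s => t - clip s)).
      exact: ccont_propagator.
    by move=> s; apply: cvgB; [exact: cvg_cst|exact: ccl].
  apply: (@ccont_comp _ (fun s => quad q (c^~ s) (c^~ s) k) clip) => //.
  exact: (traj_quad varpi01 q_le k tc tc).
have [lm _ _ _] := tc.
have m0 k := traj_ge0 k tc.
have [lcv _] := l1_conv lm lm m0 m0.
pose M k := kernel_size a * (varpi * t)^-1 * conv m m k.
have lM : l1 M by exact: l1Z.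
have zM s k : normc (z s k) <= M k.
  have := integrand_le theta rho_ge varpi01 q_le k tc tc (clip_le s).
  move=> /le_trans; apply.
  rewrite /M [leRHS]mulrAC ler_wpM2l//; last exact: nabs_weight.
  by apply: mulr_ge0; [exact: ltW|exact: conv_ge0].
rewrite (@eq_rint_oc _ _ _ _ (fun s => fourier_series (z s) x)); last first.
- move=> s /andP[s0 st]; rewrite (integrand_series t s0 (vu s (ltW s0))).
  by rewrite /z clipE// (ltW s0).
- apply: (@zsum_continuous _ _ (fun s k => complex.Re (z s k * mode k x)) _ lM).
    by move=> s k; exact: le_trans (Re_mode_le _ _ _) (zM s k).
  by move=> k; have [] := ccontM (cz k) (ccont_cst (mode k x)).
have cT k : continuous (fun s => complex.Re (z s k * mode k x)).
  by have [] := ccontM (cz k) (ccont_cst (mode k x)).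
have bT s k : `|complex.Re (z s k * mode k x)| <= M k.
  exact: le_trans (Re_mode_le _ _ _) (zM s k).
rewrite (@rint_zsum _ _ _ (fun s k => complex.Re (z s k * mode k x)) _ tt lM)//; last first.
  exact: zsum_continuous lM bT cT.
rewrite fourier_seriesE; apply: eq_zsum => k.
rewrite (duhamelE rho theta varpi01 q_le k tt tc tc) mulrC -cintZ.
  by apply: eq_rint => s sT; rewrite /z clipE// [in LHS]mulrC.
apply: ccontM; last exact: (traj_quad varpi01 q_le k tc tc).
apply: (@ccont_comp _ (propagator rho theta ^~ k) (fun s => t - s)).
  exact: ccont_propagator.
by move=> s; apply: cvgB; [exact: cvg_cst|exact: cvg_id].
Qed.

Lemma cl1_duhamel_map t : cl1 (duhamel_map rho theta q c0 c ^~ t).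
Proof.
have td := traj_duhamel_map theta rho_ge varpi01 C_gt0 q_le lc0 tc.
exact: (@traj_cl1 _ _ varpi01 _ _ t td).
Qed.

Lemma duhamel_series t x (w u : R -> R -> R) : 0 <= t ->
  (forall s, 0 <= s -> w s = fourier_series (c^~ s)) ->
  (forall s, 0 <= s -> velocity (w s) (u s)) ->
  duhamel a w_av sigma w0 w u t x =
  fourier_series (duhamel_map rho theta q c0 c ^~ t) x.
Proof.
move=> t0 wE vu; rewrite /duhamel semigroupE.
have -> : (\int[lebesgue_measure]_(tau in `[0, t]) semigroup w_av sigma (t - tau)
    (proj0 (nonlinearity a (w tau) (u tau))) x) =
  fourier_series (fun k => duhamel_integral rho theta q c c k t) x.
  have vu' s : 0 <= s -> velocity (fourier_series (c^~ s)) (u s).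
    by move=> s0; rewrite -(wE s s0); exact: vu.
  apply: etrans (duhamel_term_series x t0 vu').
  by apply: eq_rint => s /andP[s0 _]; rewrite wE.
have lS : cl1 (fun k => propagator rho theta t k * c0 k).
  apply: (cl1_le lc0) => k; rewrite Normc.normcM ler_piMl ?normc_ge0//.
  rewrite normc_propagator (le_trans (propagator_weight rho_ge varpi01 k t0))//.
  exact: weight_le1.
have mapE k : duhamel_map rho theta q c0 c k t =
    propagator rho theta t k * c0 k + duhamel_integral rho theta q c c k t.
  by rewrite /duhamel_map max_r.
have lJ : cl1 (fun k => duhamel_integral rho theta q c c k t).
  have lN := cl1N lS; have := cl1D (@cl1_duhamel_map t) lN.
  congr cl1; apply/funext => k; rewrite mapE; ring.
rewrite -(fourier_seriesD x lS lJ); congr (fourier_series _ x).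
by apply/funext => k; rewrite mapE.
Qed.

End Trajectory.
End Duhamel.

(** * The space-time norm as a majorant *)

Section Spacetime.
Context {R : realType}.
Implicit Types (x y t s : R) (k j : int) (f g : R -> R) (h : R -> R -> R).
Variable varpi : R.
Hypothesis varpi01 : 0 < varpi < 1.

Lemma abs_pow0 k : abs_pow 0 k = 1 :> R.
Proof. exact: powRr0. Qed.

Lemma wiener_normB f g : wiener f -> wiener g ->
  wiener_norm (f \- g) =
  (zsum (fun k => normc (fourier_coef f k - fourier_coef g k)))%:E.
Proof.
move=> /wiener_coefs[lf hf fE] /wiener_coefs[lg hg gE].
have cf : continuous f by rewrite fE; exact: fourier_series_continuous.
have cg : continuous g by rewrite gE; exact: fourier_series_continuous.
have cE : fourier_coef (f \- g) = fun k => fourier_coef f k - fourier_coef g k.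
  by apply/funext => k; exact: fourier_coefB.
rewrite wiener_norm_cl1 cE//.
by apply: cl1D => //; exact: cl1N.
Qed.

Lemma traj_wiener_continuous m c : trajectory varpi m c ->
  (forall t, hermitian (c^~ t)) ->
  wiener_continuous (fun t => fourier_series (c^~ t)).
Proof.
move=> tc hc; have lc t : cl1 (c^~ t) by exact: (@traj_cl1 _ _ varpi01 _ _ t tc).
have wc t : wiener (fourier_series (c^~ t)) by exact: wiener_series.
split => // t0 _; have [lm cc _ _] := tc.
have E t : wiener_norm (fourier_series (c^~ t) \- fourier_series (c^~ t0)) =
    (zsum (fun k => normc (c k t - c k t0)))%:E.
  rewrite wiener_normB//; congr EFin; apply: eq_zsum => k.
  by rewrite !fourier_coef_series.
under eq_fun do rewrite E.
apply: cvg_within_filter; apply: cvg_EFin; first exact: nearW.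
rewrite -(@zsum0 R).
apply: (@zsum_cvg _ _ _ _ (fun t k => normc (c k t - c k t0)) (fun=> 0)
  (fun k => m k + m k)).
- exact: l1D.
- by move=> k; rewrite normr0 addr_ge0 ?(traj_ge0 k tc).
- apply: nearW => t k; rewrite ger0_norm ?normc_ge0//.
  by rewrite (le_trans (le_normcD _ _))// normcN lerD// (traj_le varpi01 _ _ tc).
- move=> k; have cd : ccont (fun t => c k t - c k t0).
    by apply: ccontD => //; exact: ccont_cst.
  by have := @normc_continuous _ _ cd t0; rewrite /continuous_at subrr Normc.normc0.
Qed.

Lemma traj_spacetime m c : trajectory varpi m c -> (forall t, hermitian (c^~ t)) ->
  spacetime_space varpi 0 (fun t => fourier_series (c^~ t)).
Proof.
move=> tc hc; split; first exact: traj_wiener_continuous tc hc.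
have [lm _ _ cm] := tc.
have l2m := @l1Z _ 2 _ lm.
apply: (@le_lt_trans _ _ (\esum_(k in [set: int]) (2 * m k)%:E)); last first.
  rewrite esum_zsum ?ltry// => k.
  by rewrite mulr_ge0// (traj_ge0 k tc).
apply: le_esum => k _; rewrite abs_pow0 EFinM.
apply: lee_wpmul2l; first by rewrite lee_fin.
apply: ge_ereal_sup => _ [t t0 <-]; rewrite lee_fin.
rewrite [fourier_coef _ _](_ : _ = c k t); last first.
    by rewrite fourier_coef_series//; exact: (@traj_cl1 _ _ varpi01 _ _ t tc).
 
rewrite -/(nabs k) -ler_pdivlMl ?expR_gt0// (le_trans (cm k t t0))//.
by rewrite /weight expRN mulrC.
Qed.

(** The suprema in the norm are themselves a majorant. *)
Lemma spacetime_majorant h : (spacetime_norm varpi 0 h < +oo)%E ->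
  exists m : int -> R, l1 m /\ forall k t, 0 <= t ->
    normc (fourier_coef (h t) k) <= m k * weight varpi t k.
Proof.
rewrite /spacetime_norm => fin.
pose S k := ereal_sup [set (expR (varpi * t * `|k|%N%:R) *
  normc (fourier_coef (h t) k))%:E | t in [set t : R | (0 <= t)%R]].
have S_ge k t : 0 <= t ->
    ((expR (varpi * t * nabs k) * normc (fourier_coef (h t) k))%:E <= S k)%E.
  by move=> t0; apply: ereal_sup_ubound; exists t.
have S0 k : (0 <= S k)%E.
  apply: le_trans (S_ge k 0 (lexx _)).
  by rewrite lee_fin mulr_ge0 ?expR_ge0 ?normc_ge0.
have le1 k : (S k <= (1 + abs_pow 0 k)%:E * S k)%E.
  by rewrite abs_pow0 -[leLHS]mul1e lee_wpmul2r// lee_fin lerDl.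
have Sfin : (\esum_(k in [set: int]) S k < +oo)%E.
  by apply: le_lt_trans fin; apply: le_esum => k _; exact: le1.
have Sf k : S k \is a fin_num.
  by rewrite ge0_fin_numE// (le_lt_trans _ Sfin)// esum_term.
exists (fun k => fine (S k)); split.
  apply: l1_esum => [k|]; first exact: fine_ge0.
  by under eq_esum do rewrite fineK//.
move=> k t t0; have := S_ge k t t0; rewrite -(fineK (Sf k)) lee_fin.
by rewrite /weight expRN ler_pdivlMr ?expR_gt0// mulrC.
Qed.

Lemma spacetime_traj h : spacetime_space varpi 0 h ->
  exists m : int -> R, trajectory varpi m (fun k t => fourier_coef (h (Num.max 0 t)) k).
Proof.
move=> [[wh ch] /spacetime_majorant[m [lm hm]]]; exists m; split => //.
- move=> k.
  have m0 t : 0 <= Num.max 0 t by rewrite le_max lexx.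
  suff near0 t0 : normc (fourier_coef (h (Num.max 0 t)) k -
      fourier_coef (h (Num.max 0 t0)) k) @[t --> t0] --> (0 : R).
    split => t0; apply/cvgrPdist_lt => e e0.
      move/cvgrPdist_lt : (near0 t0) => /(_ _ e0); apply: filterS => t.
      rewrite sub0r normrN ger0_norm ?normc_ge0// normcB; apply: le_lt_trans.
      by rewrite -cReN -cReD normc_Re.
    move/cvgrPdist_lt : (near0 t0) => /(_ _ e0); apply: filterS => t.
    rewrite sub0r normrN ger0_norm ?normc_ge0// normcB; apply: le_lt_trans.
    by rewrite -cImN -cImD normc_Im.
  have maxw : (fun t => Num.max 0 t) @ t0 -->
      within [set t | 0 <= t] (nbhs (Num.max 0 t0)).
    move=> B HB.
    have H : \forall t \near t0, 0 <= Num.max 0 t -> B (Num.max 0 t) :=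
      @max0_continuous R t0 _ HB.
    have H2 : \forall t \near t0, B (Num.max 0 t).
      by move: H; apply: filterS => t; apply; exact: m0.
    exact: H2.
  have := cvg_comp _ _ maxw (ch _ (m0 t0)).
  have E t : wiener_norm (h (Num.max 0 t) \- h (Num.max 0 t0)) = _ :=
    wiener_normB (wh _ (m0 t)) (wh _ (m0 t0)).
  move=> /fine_cvgP[_ /cvgrPdist_lt H]; apply/cvgrPdist_lt => e e0.
  move: (H e e0); apply: filterS => t /=.
  rewrite E /= !sub0r !normrN; apply: le_lt_trans.
  have lB : cl1 (fun j => fourier_coef (h (Num.max 0 t)) j -
      fourier_coef (h (Num.max 0 t0)) j).
    have [l1t _ _] := wiener_coefs (wh _ (m0 t)).
    have [l1t0 _ _] := wiener_coefs (wh _ (m0 t0)).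
    by apply: cl1D => //; exact: cl1N.
  rewrite ger0_norm ?normc_ge0// (le_trans _ (ler_norm _))//.
  by apply: (nneg_term_le k lB) => j; exact: normc_ge0.
- by move=> k t; rewrite maxA maxxx.
- by move=> k t t0; rewrite max_r//; exact: hm.
Qed.

End Spacetime.

Theorem theorem3p1 (R : realType) (a w_av sigma : R) (w0 : R -> R) (varpi : R)
    (sigma_ge1 : 1 <= sigma)
    (w0_wiener : wiener w0)
    (w0_mean : mean w0 = 0)
    (w0_small : (wiener_norm w0 < (1 / (4 * (`|1 + a| + `|a|)))%:E)%E)
    (varpi_gt0 : 0 < varpi) (varpi_lt1 : varpi < 1)
    (w0_small_varpi :
      (wiener_norm w0 < ((1 - varpi) / (4 * (`|1 + a| + `|a|)))%:E)%E) :
  exists w : R -> R -> R,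
    [/\ spacetime_space varpi 0 w,
        mild_solution a w_av sigma w0 w &
        forall w' : R -> R -> R,
          spacetime_space varpi 0 w' -> mild_solution a w_av sigma w0 w' ->
          forall t x, 0 <= t -> w' t x = w t x].
Proof.
have varpi01 : 0 < varpi < 1 by rewrite varpi_gt0.
have [lc0 hc0 _] := wiener_coefs w0_wiener.
have C_gt0 := kernel_size_gt0 a.
have small : 4 * gain varpi (kernel_size a) *
    zsum (fun k => normc (fourier_coef w0 k)) < 1.
  move: w0_small_varpi; rewrite wiener_norm_cl1// lte_fin -/(kernel_size a) /gain.
  rewrite ltr_pdivlMr ?mulr_gt0// => h.
  rewrite -mulrA mulrAC mulrA ltr_pdivrMr ?subr_gt0// mul1r.
  by apply: le_lt_trans h; rewrite le_eqVlt; apply/orP; left; apply/eqP; ring.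
pose rho := @symbol_rate R sigma.
pose theta := @symbol_phase R w_av.
pose q := @kernel R a.
have rho_ge k : nabs k <= rho k by exact: symbol_rate_ge.
have q_le k j : normc (q k j) <= kernel_size a * nabs k by exact: kernel_le.
have rhoN k : rho (- k) = rho k by exact: symbol_rateN.
have thetaN k : theta (- k) = - theta k by exact: symbol_phaseN.
have qN k j : q (- k) (- j) = conjc (q k j) by exact: kernelN.
pose c := mild rho theta q (fourier_coef w0).
have tc := traj_mild theta rho_ge varpi01 C_gt0 q_le lc0 small.
have hc t : hermitian (c^~ t).
  move=> k; have m0 : 0 <= Num.max 0 t by rewrite le_max lexx.
  rewrite /c (mild_max theta rho_ge varpi01 C_gt0 q_le lc0 (- k)).
  rewrite (mild_max theta rho_ge varpi01 C_gt0 q_le lc0 k).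
  exact: (mild_hermitian rho_ge varpi01 C_gt0 q_le lc0 small rhoN thetaN qN hc0 k m0).
have lc t : cl1 (c^~ t) by exact: (@traj_cl1 _ _ varpi01 _ _ t tc).
have fc : mild_coefs rho theta q (fourier_coef w0) c.
  by move=> k t t0; exact: (mild_fixed theta rho_ge varpi01 C_gt0 q_le lc0 small k t0).
exists (fun t => fourier_series (c^~ t)); split.
- exact: (traj_spacetime varpi01 tc hc).
- exists (fun t => fourier_series (velocity_coef (c^~ t))); split.
    by move=> t _; exact: velocity_series.
  move=> t x t0.
  rewrite (@duhamel_series _ a w_av sigma varpi w0 sigma_ge1 varpi01 lc0 _ c tc hc)//.
    by congr (fourier_series _ x); apply/funext => k; exact: fc.
  by move=> s _; exact: velocity_series.
- move=> w' /[dup] sw' [[wienerw' _] _] [u' [vu' w'E]] t x t0.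
  have [m' tc'] := spacetime_traj sw'.
  set c' := fun k t => fourier_coef (w' (Num.max 0 t)) k in tc'.
  have m0 (s : R) : 0 <= Num.max 0 s by rewrite le_max lexx.
  have hc' s : hermitian (c'^~ s).
    by have [_ h _] := wiener_coefs (wienerw' _ (m0 s)).
  have w'c (s : R) : 0 <= s -> w' s = fourier_series (c'^~ s).
    by move=> s0; have [_ _] := wiener_coefs (wienerw' _ s0); rewrite /c' max_r.
  have fc' : mild_coefs rho theta q (fourier_coef w0) c'.
    move=> k s s0.
    have ws : w' s = fourier_series (duhamel_map rho theta q (fourier_coef w0) c' ^~ s).
      apply/funext => y; rewrite w'E//.
      by rewrite (@duhamel_series _ a w_av sigma varpi w0 sigma_ge1 varpi01 lc0 _ c' tc' hc').
    rewrite {1}/c' max_r// ws fourier_coef_series//.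
      exact: (@cl1_duhamel_map R a w_av sigma varpi w0 sigma_ge1 varpi01 lc0 m' c' tc' s).
    move=> j.
    have rc' : conj_reflect c' = c'.
      by apply/funext => i; apply/funext => r; rewrite /conj_reflect hc' cconjK.
    have := duhamel_map_reflect varpi01 q_le rhoN thetaN qN hc0 j s tc'.
    by rewrite rc' /conj_reflect => ->; rewrite cconjK.
  rewrite w'c//; congr (fourier_series _ x); apply/funext => k.
  exact: (mild_coefs_unique rho_ge varpi01 C_gt0 q_le lc0 small k tc' tc fc' fc t0).
Qed.
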